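(* Let $G=(V,E)$ be a directed acyclic graph with $n=|V|$ and let $E=E_1\dot\cup E_2$ where both $(V,E_1)$ and $(V,E_2)$ are matchings. Then it can be decided in $O(n)$ time whether $(G,\{E_1,E_2\})$ is a positive instance of \textsc{Upward Matching-Partitioned 2-Page Book Embedding}, i.e. whether there is a linear ordering $\pi$ of $V$ that is a topological order of $G$ and in which no two edges of $E_1$ cross and no two edges of $E_2$ cross.
   Context: Two edges with endpoints $p_1,q_1$ and $p_2,q_2$ (with $\pi(p_t)<\pi(q_t)$, all four endpoints distinct) cross with respect to a linear ordering $\pi$ iff $\pi(p_1)<\pi(p_2)<\pi(q_1)<\pi(q_2)$ or $\pi(p_2)<\pi(p_1)<\pi(q_2)<\pi(q_1)$. A topological order is an ordering with $\pi(u)<\pi(v)$ for every edge $(u,v)$. *)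

(* Defs.v *)
From Stdlib Require Import Arith List Relations.
Import ListNotations.

(* Graphs: vertex set V = {0, ..., n-1}; an edge (u,v) is directed u -> v. *)

Definition edge := (nat * nat)%type.

Definition edges_in_range (n : nat) (E : list edge) : Prop :=
  forall u v, In (u, v) E -> u < n /\ v < n.

Definition is_matching (E : list edge) : Prop :=
  NoDup E /\
  (forall u v, In (u, v) E -> u <> v) /\
  (forall u1 v1 u2 v2, In (u1, v1) E -> In (u2, v2) E -> (u1, v1) <> (u2, v2) ->
     u1 <> u2 /\ u1 <> v2 /\ v1 <> u2 /\ v1 <> v2).

Definition adj (E : list edge) : relation nat := fun u v => In (u, v) E.

Definition acyclic (E : list edge) : Prop :=
  forall v, ~ clos_trans nat (adj E) v v.

(* A linear ordering pi of V = {0..n-1}: a bijection V -> {0..n-1}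
   (position of each vertex). *)
Definition linear_ordering (n : nat) (pi : nat -> nat) : Prop :=
  (forall v, v < n -> pi v < n) /\
  (forall u v, u < n -> v < n -> pi u = pi v -> u = v).

Definition topological (pi : nat -> nat) (E : list edge) : Prop :=
  forall u v, In (u, v) E -> pi u < pi v.

Definition cross (pi : nat -> nat) (e1 e2 : edge) : Prop :=
  let a1 := Nat.min (pi (fst e1)) (pi (snd e1)) in
  let b1 := Nat.max (pi (fst e1)) (pi (snd e1)) in
  let a2 := Nat.min (pi (fst e2)) (pi (snd e2)) in
  let b2 := Nat.max (pi (fst e2)) (pi (snd e2)) in
  (a1 < a2 /\ a2 < b1 /\ b1 < b2) \/ (a2 < a1 /\ a1 < b2 /\ b2 < b1).

Definition no_crossing (pi : nat -> nat) (E : list edge) : Prop :=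
  forall e f, In e E -> In f E -> e <> f -> ~ cross pi e f.

Definition upward_mp2_book_embeddable (n : nat) (E1 E2 : list edge) : Prop :=
  exists pi, linear_ordering n pi /\ topological pi (E1 ++ E2) /\
             no_crossing pi E1 /\ no_crossing pi E2.

Definition valid_instance (n : nat) (E1 E2 : list edge) : Prop :=
  edges_in_range n (E1 ++ E2) /\
  acyclic (E1 ++ E2) /\
  is_matching E1 /\ is_matching E2 /\
  (forall e, In e E1 -> ~ In e E2).

(* Machine model for "O(n) time": a unit-cost RAM over natural numbers   *)
(* with unbounded memory, direct and indirect addressing, addition,     *)
(* truncated subtraction, conditional jump (no multiplication, so no    *)
(* hidden parallelism via huge-number arithmetic).                     *)

Inductive instr : Type :=
| IConst (i k : nat)
| IAdd (i j k : nat)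
| ISub (i j k : nat)
| ILoad (i j : nat)
| IStore (i j : nat)
| IJz (i l : nat)
| IJmp (l : nat)
| IHalt.

Definition program := list instr.
Definition memory := nat -> nat.
Definition config := (nat * memory)%type.

Definition upd (m : memory) (a x : nat) : memory :=
  fun b => if Nat.eqb b a then x else m b.

Definition step (P : program) (c : config) : config :=
  let (pc, m) := c in
  match nth_error P pc with
  | None | Some IHalt => (pc, m)
  | Some (IConst i k) => (S pc, upd m i k)
  | Some (IAdd i j k) => (S pc, upd m i (m j + m k))
  | Some (ISub i j k) => (S pc, upd m i (m j - m k))
  | Some (ILoad i j) => (S pc, upd m i (m (m j)))
  | Some (IStore i j) => (S pc, upd m (m i) (m j))
  | Some (IJz i l) => (if Nat.eqb (m i) 0 then l else S pc, m)
  | Some (IJmp l) => (l, m)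
  end.

Definition halted (P : program) (c : config) : Prop :=
  match nth_error P (fst c) with
  | None | Some IHalt => True
  | _ => False
  end.

Definition run (P : program) (m : memory) (t : nat) : config :=
  Nat.iter t (step P) (0, m).

Fixpoint flat_edges (E : list edge) : list nat :=
  match E with
  | [] => []
  | (u, v) :: E' => u :: v :: flat_edges E'
  end.

Definition encode (n : nat) (E1 E2 : list edge) : memory :=
  let l := n :: length E1 :: length E2 :: flat_edges (E1 ++ E2) in
  fun a => nth a l 0.

(* Main.v *)
Require Import Defs.
From Stdlib Require Import Arith List Lia ZArith Bool.
Import ListNotations.

(** The connected components of [G] are paths and cycles alternating between the
    two matchings. A vertex with at most one neighbour can always be inserted right
    beside that neighbour, so only the cycles are obstructed. Drawing the edges of
    [E1] above and those of [E2] below the line turns a cycle into a closed meander,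
    whose turning number is [1] or [-1]; hence, going around the cycle, the numbers
    of clockwise and of counterclockwise arcs, which depend on the directions of the
    edges only, differ by exactly two. Conversely, a cyclic sequence of half turns
    of sum [2] or [-2] is realized by a closed meander: two consecutive half turns
    in opposite directions can be contracted until two arcs are left.

    Let [m1] and [m2] exchange the endpoints of the edges of [E1] and [E2] and fix
    all other vertices. The vertices of a cycle are visited by two orbits of the
    permutation [m2 o m1], one for each sense of traversal. Walking along every
    orbit once and counting half turns takes linear time. *)

(** * Structured programs for the machine *)

(** On a path component the orbits of [m2 o m1] close up as well, since the walk turns back wherever
    a matching fixes the current vertex. A cycle is therefore recognized by meeting no such fixed
    point, and only then does its turn count matter. An edge followed along its direction leads to
    the right in every topological order; this is why the sense of each half turn is known before
    any ordering is. The converse needs room for insertions, so orderings are replaced by injective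
    maps into the integers: scaling by 3 opens a gap on either side of every used position, and
    ranks recover an ordering at the end. Components do not interact, because a realized cycle can
    be shifted to the right of everything placed so far. The machine has only truncated subtraction;
    absolute differences, which test equality of vertices and compare counts, are computed as (a -
    b) + (b - a). *)

Definition exec_basic (i : instr) (m : memory) : option memory :=
  match i with
  | IConst i k => Some (upd m i k)
  | IAdd i j k => Some (upd m i (m j + m k))
  | ISub i j k => Some (upd m i (m j - m k))
  | ILoad i j => Some (upd m i (m (m j)))
  | IStore i j => Some (upd m (m i) (m j))
  | _ => None
  end.

Inductive com : Type :=
| CBlock (l : list instr)
| CSeq (c1 c2 : com)
| CIfz (r : nat) (c1 c2 : com)
| CWhile (r : nat) (c : com).

Inductive exec_block : list instr -> memory -> memory -> Prop :=
| EBnil m : exec_block [] m m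
| EBcons i l m m1 m2 :
    exec_basic i m = Some m1 -> exec_block l m1 m2 -> exec_block (i :: l) m m2.

(** The number is the exact count of machine steps of the compiled code. There the nonzero branch of
    a conditional comes first and needs a closing jump, whence [S (S t)] against [S t]; each round
    of a loop pays for one test and one jump back. *)
Inductive exec : com -> memory -> nat -> memory -> Prop :=
| EBlock l m m' : exec_block l m m' -> exec (CBlock l) m (length l) m'
| ESeq c1 c2 m m1 m2 t1 t2 :
    exec c1 m t1 m1 -> exec c2 m1 t2 m2 -> exec (CSeq c1 c2) m (t1 + t2) m2
| EIfz0 r c1 c2 m m' t :
    m r = 0 -> exec c1 m t m' -> exec (CIfz r c1 c2) m (S t) m'
| EIfzS r c1 c2 m m' t :
    m r <> 0 -> exec c2 m t m' -> exec (CIfz r c1 c2) m (S (S t)) m'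
| EWhile0 r c m : m r = 0 -> exec (CWhile r c) m 1 m
| EWhileS r c m m1 m2 t1 t2 :
    m r <> 0 -> exec c m t1 m1 -> exec (CWhile r c) m1 t2 m2 ->
    exec (CWhile r c) m (S t1 + S t2) m2.

Fixpoint size (c : com) : nat :=
  match c with
  | CBlock l => length l
  | CSeq c1 c2 => size c1 + size c2
  | CIfz _ c1 c2 => S (size c2 + S (size c1))
  | CWhile _ c => S (size c + 1)
  end.

Fixpoint compile (b : nat) (c : com) : program :=
  match c with
  | CBlock l => l
  | CSeq c1 c2 => compile b c1 ++ compile (b + size c1) c2
  | CIfz r c1 c2 =>
      IJz r (S (S (b + size c2))) :: compile (S b) c2 ++
      IJmp (S (S (b + size c2 + size c1))) :: compile (S (S (b + size c2))) c1
  | CWhile r c =>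
      IJz r (S (S (b + size c))) :: compile (S b) c ++ [IJmp b]
  end.

Lemma length_compile c : forall b, length (compile b c) = size c.
Proof.
  induction c; intros b; simpl; rewrite ?length_app; simpl;
    rewrite ?IHc1, ?IHc2, ?IHc; lia.
Qed.

Definition code_at (P : program) (b : nat) (l : program) : Prop :=
  forall i, i < length l -> nth_error P (b + i) = nth_error l i.

Lemma code_at_app P b l1 l2 :
  code_at P b (l1 ++ l2) -> code_at P b l1 /\ code_at P (b + length l1) l2.
Proof.
  unfold code_at; rewrite length_app; intros H; split; intros i Hi.
  - rewrite H by lia. now apply nth_error_app1.
  - rewrite <- Nat.add_assoc, H by lia. rewrite nth_error_app2 by lia. f_equal; lia.
Qed.

Lemma code_at_cons P b i l :
  code_at P b (i :: l) -> nth_error P b = Some i /\ code_at P (S b) l.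
Proof.
  unfold code_at; simpl; intros H; split.
  - rewrite <- (Nat.add_0_r b), H by lia. reflexivity.
  - intros j Hj. specialize (H (S j)). rewrite Nat.add_succ_r in H. apply H. lia.
Qed.

Lemma iter_step_add P t1 t2 c :
  Nat.iter (t1 + t2) (step P) c = Nat.iter t2 (step P) (Nat.iter t1 (step P) c).
Proof. rewrite Nat.add_comm. apply Nat.iter_add. Qed.

Lemma iter_step_S P t c :
  Nat.iter (S t) (step P) c = Nat.iter t (step P) (step P c).
Proof. apply Nat.iter_succ_r. Qed.

Lemma step_jz P b r l m : nth_error P b = Some (IJz r l) ->
  step P (b, m) = (if m r =? 0 then l else S b, m).
Proof. simpl. now intros ->. Qed.

Lemma step_jmp P b l m : nth_error P b = Some (IJmp l) -> step P (b, m) = (l, m).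
Proof. simpl. now intros ->. Qed.

Lemma exec_block_steps P l m m' :
  exec_block l m m' -> forall b, code_at P b l ->
  Nat.iter (length l) (step P) (b, m) = (b + length l, m').
Proof.
  induction 1 as [m|i l m m1 m2 Hi Hl IH]; intros b Hb.
  - simpl. f_equal; lia.
  - apply code_at_cons in Hb as [H0 Hb].
    simpl length. rewrite iter_step_S.
    replace (step P (b, m)) with (S b, m1).
    + rewrite IH by assumption. f_equal; lia.
    + simpl. rewrite H0. destruct i; simpl in Hi; congruence.
Qed.

Lemma exec_steps P c m t m' :
  exec c m t m' -> forall b, code_at P b (compile b c) ->
  Nat.iter t (step P) (b, m) = (b + size c, m').
Proof.
  induction 1 as
    [ l m m' Hl | c1 c2 m m1 m2 t1 t2 _ IH1 _ IH2
    | r c1 c2 m m' t Hr _ IH | r c1 c2 m m' t Hr _ IH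
    | r c m Hr | r c m m1 m2 t1 t2 Hr _ IH1 _ IH2 ];
    intros b Hb; simpl in Hb |- *.
  - now apply exec_block_steps.
  - apply code_at_app in Hb as [Hb1 Hb2]. rewrite length_compile in Hb2.
    rewrite iter_step_add, IH1, IH2 by assumption. f_equal; lia.
  - apply code_at_cons in Hb as [H0 Hb].
    apply code_at_app in Hb as [_ Hb].
    apply code_at_cons in Hb as [_ Hb]. rewrite length_compile in Hb.
    change (step P (Nat.iter t (step P) (b, m)))
      with (Nat.iter (S t) (step P) (b, m)).
    rewrite iter_step_S, (step_jz _ _ _ _ _ H0), Hr. simpl.
    rewrite IH by exact Hb. f_equal; lia.
  - apply code_at_cons in Hb as [H0 Hb].
    apply code_at_app in Hb as [Hb1 Hb].
    apply code_at_cons in Hb as [H1 _]. rewrite length_compile in H1.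
    change (step P (step P (Nat.iter t (step P) (b, m))))
      with (step P (Nat.iter (S t) (step P) (b, m))).
    rewrite iter_step_S, (step_jz _ _ _ _ _ H0).
    destruct (Nat.eqb_spec (m r) 0) as [|_]; [lia|].
    rewrite IH by exact Hb1. rewrite (step_jmp _ _ _ _ H1). f_equal; lia.
  - apply code_at_cons in Hb as [H0 _].
    change (step P (b, m) = (b + S (size c + 1), m)).
    rewrite (step_jz _ _ _ _ _ H0), Hr. simpl. f_equal; lia.
  - assert (Hw := Hb).
    apply code_at_cons in Hb as [H0 Hb].
    apply code_at_app in Hb as [Hb1 Hb].
    apply code_at_cons in Hb as [H1 _]. rewrite length_compile in H1.
    change (step P (Nat.iter (t1 + S t2) (step P) (b, m)))
      with (Nat.iter (S (t1 + S t2)) (step P) (b, m)).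
    rewrite iter_step_S, (step_jz _ _ _ _ _ H0).
    destruct (Nat.eqb_spec (m r) 0) as [|_]; [lia|].
    rewrite iter_step_add, IH1 by exact Hb1.
    rewrite iter_step_S, (step_jmp _ _ _ _ H1).
    rewrite IH2 by exact Hw. reflexivity.
Qed.

Lemma halted_iter P t c : halted P c -> Nat.iter t (step P) c = c.
Proof.
  intros H. induction t as [|t IH]; simpl; [reflexivity|]. rewrite IH.
  destruct c as [pc m]. unfold halted in H. simpl in *.
  destruct (nth_error P pc) as [[]|]; tauto.
Qed.

(** Control leaves the code at its end, where there is no instruction, so the machine is halted
    there and surplus steps change nothing. An upper bound on the running time is thus enough. *)
Lemma run_compiled c m t m' T :
  exec c m t m' -> t <= T ->
  run (compile 0 c) m T = (size c, m') /\ halted (compile 0 c) (size c, m').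
Proof.
  intros He Ht.
  assert (Hh : halted (compile 0 c) (size c, m')).
  { unfold halted. simpl.
    replace (nth_error (compile 0 c) (size c)) with (@None instr); [exact I|].
    symmetry. apply nth_error_None. now rewrite length_compile. }
  split; [|exact Hh].
  unfold run. replace T with (t + (T - t)) by lia.
  rewrite iter_step_add, (exec_steps _ _ _ _ _ He 0) by (intros i _; reflexivity).
  now apply halted_iter.
Qed.

(* Cells below [16] serve as registers and are tracked as an explicit list;
   indirect accesses must stay outside of them. *)
Definition rep (rs : list nat) (h : memory) (m : memory) : Prop :=
  length rs = 16 /\ (forall i, i < 16 -> m i = nth i rs 0) /\
  (forall a, 16 <= a -> m a = h a).

Fixpoint set_nth (rs : list nat) (i x : nat) : list nat :=
  match rs, i with
  | [], _ => []
  | _ :: rs, 0 => x :: rs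
  | y :: rs, S i => y :: set_nth rs i x
  end.

Lemma length_set_nth rs : forall i x, length (set_nth rs i x) = length rs.
Proof. induction rs; intros [|i] x; simpl; auto. Qed.

Lemma nth_set_nth rs : forall i x j, i < length rs ->
  nth j (set_nth rs i x) 0 = if j =? i then x else nth j rs 0.
Proof.
  induction rs as [|y rs IH]; intros i x j Hi; simpl in Hi; [lia|].
  destruct i as [|i], j as [|j]; simpl; auto. apply IH; lia.
Qed.

(** * Weakest preconditions with running times *)

Definition wp (c : com) (rs : list nat) (h : memory)
    (Q : nat -> list nat -> memory -> Prop) : Prop :=
  forall m, rep rs h m ->
  exists t m' rs' h', exec c m t m' /\ rep rs' h' m' /\ Q t rs' h'.

Fixpoint wp_instrs (l : list instr) (rs : list nat) (h : memory)
    (Q : list nat -> memory -> Prop) : Prop :=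
  match l with
  | [] => Q rs h
  | i :: l =>
      match i with
      | IConst i k => i < 16 /\ wp_instrs l (set_nth rs i k) h Q
      | IAdd i j k => i < 16 /\ j < 16 /\ k < 16 /\
          wp_instrs l (set_nth rs i (nth j rs 0 + nth k rs 0)) h Q
      | ISub i j k => i < 16 /\ j < 16 /\ k < 16 /\
          wp_instrs l (set_nth rs i (nth j rs 0 - nth k rs 0)) h Q
      | ILoad i j => i < 16 /\ j < 16 /\ 16 <= nth j rs 0 /\
          wp_instrs l (set_nth rs i (h (nth j rs 0))) h Q
      | IStore i j => i < 16 /\ j < 16 /\ 16 <= nth i rs 0 /\
          wp_instrs l rs (upd h (nth i rs 0) (nth j rs 0)) Q
      | _ => False
      end
  end.

Lemma rep_set rs h m i x :
  rep rs h m -> i < 16 -> rep (set_nth rs i x) h (upd m i x).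
Proof.
  intros (Hl & Hr & Hh) Hi. split; [|split].
  - now rewrite length_set_nth.
  - intros j Hj. rewrite nth_set_nth by lia. unfold upd.
    destruct (j =? i); auto.
  - intros a Ha. unfold upd. destruct (Nat.eqb_spec a i); [lia|auto].
Qed.

Lemma rep_store rs h m a x :
  rep rs h m -> 16 <= a -> rep rs (upd h a x) (upd m a x).
Proof.
  intros (Hl & Hr & Hh) Ha. split; [|split]; trivial.
  - intros j Hj. unfold upd. destruct (Nat.eqb_spec j a); [lia|auto].
  - intros b Hb. unfold upd. destruct (b =? a); auto.
Qed.

Lemma wp_instrs_exec l : forall rs h Q m, rep rs h m -> wp_instrs l rs h Q ->
  exists m' rs' h', exec_block l m m' /\ rep rs' h' m' /\ Q rs' h'.
Proof.
  induction l as [|i l IH]; intros rs h Q m Hm HQ.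
  - exists m, rs, h. repeat split; try apply Hm; [constructor|exact HQ].
  - assert (step1 : exists m1 rs1 h1, exec_basic i m = Some m1 /\
              rep rs1 h1 m1 /\ wp_instrs l rs1 h1 Q).
    { assert (Hm' := Hm). destruct Hm' as (_ & Hr & Hh).
      destruct i; simpl in HQ; try contradiction.
      - exists (upd m i k). eexists _, _. split; [reflexivity|].
        split; [|apply HQ]. apply rep_set; tauto.
      - destruct HQ as (Hi & Hj & Hk & HQ). eexists _, _, _.
        split; [reflexivity|]. split; [|exact HQ]. rewrite !Hr by assumption.
        now apply rep_set.
      - destruct HQ as (Hi & Hj & Hk & HQ). eexists _, _, _.
        split; [reflexivity|]. split; [|exact HQ]. rewrite !Hr by assumption.
        now apply rep_set.
      - destruct HQ as (Hi & Hj & Hk & HQ). eexists _, _, _.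
        split; [reflexivity|]. split; [|exact HQ]. rewrite (Hr j), Hh by assumption.
        now apply rep_set.
      - destruct HQ as (Hi & Hj & Hk & HQ). eexists _, _, _.
        split; [reflexivity|]. split; [|exact HQ]. rewrite !Hr by assumption.
        now apply rep_store. }
    destruct step1 as (m1 & rs1 & h1 & He & Hm1 & HQ1).
    destruct (IH _ _ _ _ Hm1 HQ1) as (m' & rs' & h' & Hl & HR).
    exists m', rs', h'. split; [|exact HR]. econstructor; eauto.
Qed.

Lemma wp_block l t rs h (Q : nat -> list nat -> memory -> Prop) :
  length l = t -> wp_instrs l rs h (Q t) -> wp (CBlock l) rs h Q.
Proof.
  intros <- H m Hm.
  destruct (wp_instrs_exec _ _ _ _ _ Hm H) as (m' & rs' & h' & He & HR).
  exists (length l), m', rs', h'. split; [now constructor|exact HR].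
Qed.

Lemma wp_seq c1 c2 rs h Q :
  wp c1 rs h (fun t1 rs1 h1 => wp c2 rs1 h1 (fun t2 => Q (t1 + t2))) ->
  wp (CSeq c1 c2) rs h Q.
Proof.
  intros H m Hm. destruct (H m Hm) as (t1 & m1 & rs1 & h1 & He1 & Hm1 & H1).
  destruct (H1 m1 Hm1) as (t2 & m2 & rs2 & h2 & He2 & HR).
  exists (t1 + t2), m2, rs2, h2. split; [econstructor; eauto|exact HR].
Qed.

Lemma wp_mono c rs h (Q R : nat -> list nat -> memory -> Prop) :
  wp c rs h Q -> (forall t rs' h', Q t rs' h' -> R t rs' h') -> wp c rs h R.
Proof.
  intros H HQR m Hm. destruct (H m Hm) as (t & m' & rs' & h' & He & Hm' & HQ).
  exists t, m', rs', h'. auto.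
Qed.

Lemma wp_ifz r c1 c2 rs h (Q : nat -> list nat -> memory -> Prop) :
  r < 16 ->
  (nth r rs 0 = 0 -> wp c1 rs h (fun t => Q (S t))) ->
  (nth r rs 0 <> 0 -> wp c2 rs h (fun t => Q (S (S t)))) ->
  wp (CIfz r c1 c2) rs h Q.
Proof.
  intros Hr H0 HS m Hm. assert (E : m r = nth r rs 0) by now apply Hm.
  destruct (Nat.eq_dec (nth r rs 0) 0) as [Z|Z].
  - destruct (H0 Z m Hm) as (t & m' & rs' & h' & He & HR).
    exists (S t), m', rs', h'. split; [apply EIfz0; trivial; lia|exact HR].
  - destruct (HS Z m Hm) as (t & m' & rs' & h' & He & HR).
    exists (S (S t)), m', rs', h'. split; [apply EIfzS; trivial; lia|exact HR].
Qed.

(* Amortised running time: each iteration is paid for by the decrease of [Phi]. *)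
Lemma wp_while r c (Inv : list nat -> memory -> Prop)
    (Phi : list nat -> memory -> nat) rs h :
  r < 16 ->
  (forall rs h, Inv rs h -> nth r rs 0 <> 0 ->
     wp c rs h (fun t rs' h' => Inv rs' h' /\ t + 2 + Phi rs' h' <= Phi rs h)) ->
  Inv rs h ->
  wp (CWhile r c) rs h (fun t rs' h' =>
    Inv rs' h' /\ nth r rs' 0 = 0 /\ t + Phi rs' h' <= S (Phi rs h)).
Proof.
  intros Hr Hbody. remember (Phi rs h) as k eqn:Ek.
  revert rs h Ek. induction k as [k IH] using lt_wf_ind. intros rs h Ek HI m Hm.
  assert (E : m r = nth r rs 0) by now apply Hm.
  destruct (Nat.eq_dec (nth r rs 0) 0) as [Z|Z].
  - exists 1, m, rs, h. split; [constructor; lia|]. repeat split; try apply Hm; trivial; lia.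
  - destruct (Hbody rs h HI Z m Hm) as (t1 & m1 & rs1 & h1 & He1 & Hm1 & HI1 & Ht1).
    destruct (IH (Phi rs1 h1) ltac:(lia) rs1 h1 eq_refl HI1 m1 Hm1)
      as (t2 & m2 & rs2 & h2 & He2 & Hm2 & HI2 & Hz & Ht2).
    exists (S t1 + S t2), m2, rs2, h2.
    split; [eapply EWhileS; eauto; lia|]. repeat split; try apply Hm2; trivial; lia.
Qed.

(** * Closed meanders *)

Fixpoint zsum (f : nat -> Z) (n : nat) : Z :=
  match n with
  | 0 => 0%Z
  | S n => (zsum f n + f n)%Z
  end.

Lemma zsum_ext f g n : (forall i, i < n -> f i = g i) -> zsum f n = zsum g n.
Proof.
  induction n as [|n IH]; simpl; intros H; [reflexivity|].
  rewrite IH, (H n); auto.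
Qed.

Lemma zsum_S f n : zsum f (S n) = (f 0%nat + zsum (fun i => f (S i)) n)%Z.
Proof.
  induction n as [|n IH]; [simpl; lia|].
  change (zsum f (S (S n))) with (zsum f (S n) + f (S n))%Z.
  rewrite IH. simpl. lia.
Qed.

Lemma zsum_telescope (f : nat -> Z) n : zsum (fun i => f (S i) - f i)%Z n = (f n - f 0%nat)%Z.
Proof. induction n as [|n IH]; simpl; lia. Qed.

Lemma zsum_sub f g n : zsum (fun i => f i - g i)%Z n = (zsum f n - zsum g n)%Z.
Proof. induction n as [|n IH]; simpl; lia. Qed.

Lemma zsum_opp f n : zsum (fun i => - f i)%Z n = (- zsum f n)%Z.
Proof. induction n as [|n IH]; simpl; lia. Qed.

Local Open Scope Z_scope.

Definition crossZ (a b c d : Z) : Prop :=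
  (Z.min a b < Z.min c d /\ Z.min c d < Z.max a b /\ Z.max a b < Z.max c d) \/
  (Z.min c d < Z.min a b /\ Z.min a b < Z.max c d /\ Z.max c d < Z.max a b).

(* [side i] is [1] when the [i]-th arc of a closed meander runs above the line
   and [-1] when it runs below. *)
Definition side (i : nat) : Z := if Nat.even i then 1 else -1.

Lemma side_S i : side (S i) = - side i.
Proof. unfold side. rewrite Nat.even_succ, <- Nat.negb_even. now destruct (Nat.even i). Qed.

Record closed_meander (N : nat) (P : nat -> Z) : Prop := {
  cm_closed : P N = P 0%nat;
  cm_inj : forall i j, (i < j < N)%nat -> P i <> P j;
  cm_nocross : forall i j, (i < j < N)%nat -> Nat.even i = Nat.even j ->
    ~ crossZ (P i) (P (S i)) (P j) (P (S j)) }.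

(* [1] for a clockwise and [-1] for a counterclockwise half turn. *)
Definition turn (P : nat -> Z) (i : nat) : Z := side i * Z.sgn (P (S i) - P i).

(* Forgetting the first point exchanges the two sides; the reflection restores
   the turning directions. *)
Definition rot (N : nat) (P : nat -> Z) (i : nat) : Z :=
  if (i =? N)%nat then - P 1%nat else - P (S i).

Lemma rot_meander N P : Nat.even N = true -> (0 < N)%nat ->
  closed_meander N P -> closed_meander N (rot N P).
Proof.
  intros HN HN0 [Hc Hi Hx]. unfold rot. split.
  - rewrite Nat.eqb_refl. destruct (Nat.eqb_spec 0 N); [lia|reflexivity].
  - intros i j Hij. destruct (Nat.eqb_spec i N), (Nat.eqb_spec j N); try lia.
    destruct (Nat.eq_dec (S j) N) as [E|E].
    + rewrite E, Hc. specialize (Hi 0%nat (S i)). lia.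
    + specialize (Hi (S i) (S j)). lia.
  - intros i j Hij Hpar.
    assert (Hx' : forall i j, (i < j < N)%nat -> Nat.even i = Nat.even j ->
      ~ crossZ (P j) (P (S j)) (P i) (P (S i))).
    { intros i' j' H1 H2 H3. apply (Hx i' j' H1 H2). unfold crossZ in *. lia. }
    destruct (Nat.eqb_spec i N), (Nat.eqb_spec j N), (Nat.eqb_spec (S i) N); try lia.
    destruct (Nat.eqb_spec (S j) N) as [E|E].
    + rewrite E, Hc.
      assert (Hp : Nat.even (S i) = Nat.even 0).
      { rewrite Nat.even_succ, <- Nat.negb_even, Hpar.
        rewrite <- E, Nat.even_succ, <- Nat.negb_even in HN. now rewrite HN. }
      specialize (Hx' 0%nat (S i) ltac:(lia) (eq_sym Hp)).
      intros H. apply Hx'. unfold crossZ in *. lia.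
    + specialize (Hx' (S i) (S j) ltac:(lia)).
      rewrite !Nat.even_succ, <- !Nat.negb_even, Hpar in Hx'.
      specialize (Hx' eq_refl). intros H. apply Hx'. unfold crossZ in *. lia.
Qed.

Lemma turn_rot N P i : (S i < N)%nat -> turn (rot N P) i = turn P (S i).
Proof.
  intros Hi. unfold turn, rot. rewrite side_S.
  destruct (Nat.eqb_spec i N), (Nat.eqb_spec (S i) N); lia.
Qed.

Lemma turn_rot_last n P : Nat.even (S n) = true -> P (S n) = P 0%nat ->
  turn (rot (S n) P) n = turn P 0%nat.
Proof.
  intros Hn Hc. unfold turn, rot. rewrite Nat.eqb_refl.
  destruct (Nat.eqb_spec n (S n)); [lia|]. rewrite Hc.
  replace (side n) with (-1).
  - replace (- P 1%nat - - P 0%nat) with (- (P 1%nat - P 0%nat)) by lia.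
    rewrite Z.sgn_opp. change (side 0) with 1. lia.
  - unfold side. rewrite Nat.even_succ, <- Nat.negb_even in Hn.
    now destruct (Nat.even n).
Qed.

Lemma zsum_turn_rot N P : Nat.even N = true -> P N = P 0%nat ->
  zsum (turn (rot N P)) N = zsum (turn P) N.
Proof.
  intros HN Hc. destruct N as [|n]; [reflexivity|].
  rewrite (zsum_S (turn P)). simpl zsum. rewrite turn_rot_last by assumption.
  rewrite (zsum_ext (turn (rot (S n) P)) (fun i => turn P (S i))); [lia|].
  intros i Hi. apply turn_rot. lia.
Qed.

(* A discrete form of Hopf's proof of the Umlaufsatz. The direction of the secant
   from the [i]-th to the [j]-th point turns by the same amount along the two
   ways around the square [(i,j)], [(i+1,j)], [(i,j+1)], [(i+1,j+1)]; for arcs on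
   the same side this says that they do not cross. Summing over all squares
   compares the turning of the curve with the turning of the secant from its
   leftmost point. *)
Lemma secant_square N P i j (s := fun i j => Z.sgn (P j - P i)) :
  Nat.even N = true -> closed_meander N P -> (S i < j < N)%nat ->
  side i * (s (S i) (S j) - s i (S j)) - side i * (s (S i) j - s i j) =
  side j * (s (S i) j - s (S i) (S j)) - side j * (s i j - s i (S j)).
Proof.
  intros HN [Hc Hi Hx] Hij. unfold side.
  destruct (Bool.bool_dec (Nat.even i) (Nat.even j)) as [E|E].
  - specialize (Hx i j ltac:(lia) E).
    (* The two arcs share no endpoint. The only danger is that the last arc closes up at the start
       of the first, but for even [N] these two lie on opposite sides. *)
    assert (D : P i <> P (S j) /\ P (S i) <> P (S j)).
    { destruct (Nat.eq_dec (S j) N) as [EN|EN].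
      - rewrite EN, Hc. destruct i as [|i].
        + rewrite <- EN, Nat.even_succ, <- Nat.negb_even, <- E in HN. discriminate.
        + split; intros H; symmetry in H; revert H; apply Hi; lia.
      - split; apply Hi; lia. }
    assert (D1 := Hi i (S i) ltac:(lia)). assert (D2 := Hi i j ltac:(lia)).
    assert (D3 := Hi (S i) j ltac:(lia)).
    assert (D4 : P j <> P (S j)).
    { destruct (Nat.eq_dec (S j) N) as [EN|EN].
      - rewrite EN, Hc. apply not_eq_sym, Hi. lia.
      - apply Hi. lia. }
    rewrite E. unfold s, crossZ in *. clear - Hx D D1 D2 D3 D4.
    destruct (Nat.even j);
    destruct (Z.sgn_spec (P j - P i)) as [[? ->]|[[? ->]|[? ->]]];
    destruct (Z.sgn_spec (P j - P (S i))) as [[? ->]|[[? ->]|[? ->]]];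
    destruct (Z.sgn_spec (P (S j) - P i)) as [[? ->]|[[? ->]|[? ->]]];
    destruct (Z.sgn_spec (P (S j) - P (S i))) as [[? ->]|[[? ->]|[? ->]]]; lia.
  - clearbody s. destruct (Nat.even i), (Nat.even j); try congruence; ring.
Qed.

Lemma turning_number_leftmost N P :
  Nat.even N = true -> (0 < N)%nat -> closed_meander N P ->
  (forall i, (0 < i < N)%nat -> P 0%nat < P i) ->
  zsum (turn P) N = 2.
Proof.
  intros HN HN0 HP Hmin.
  set (s := fun i j => Z.sgn (P j - P i)).
  (* [W n] is the turning of the secant to point [S n] while its other end runs from point 0 to
     point [n]; a change of [s] along arc [i] counts with the sign of the side of that arc. *)
  set (W := fun n => zsum (fun i => side i * (s (S i) (S n) - s i (S n))) n).
  assert (Hs0 : forall j, (0 < j < N)%nat -> s 0%nat j = 1 /\ s j N = -1).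
  { intros j Hj. specialize (Hmin j Hj). unfold s.
    rewrite (cm_closed _ _ HP). split; [apply Z.sgn_pos|apply Z.sgn_neg]; lia. }
  assert (HsN : s 0%nat N = 0).
  { unfold s. rewrite (cm_closed _ _ HP), Z.sub_diag. reflexivity. }
  assert (Hturn : forall i, turn P i = side i * s i (S i)) by reflexivity.
  assert (step : forall n, (S n < N)%nat ->
    W (S n) = W n - turn P n - turn P (S n)
              - side (S n) * (s 0%nat (S n) - s 0%nat (S (S n)))).
  { intros n Hn. unfold W. simpl zsum.
    (* [H i] records the change when the far end of the secant moves along arc [S n] and [i] stays
       fixed. By the square identity the difference of [W (S n)] and [W n] telescopes in [H]; the
       terms next to the diagonal become the turns at [n] and [S n]. *)
    set (H := fun i => side (S n) * (s i (S n) - s i (S (S n)))).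
    assert (T : zsum (fun i => side i * (s (S i) (S (S n)) - s i (S (S n)))) n -
                zsum (fun i => side i * (s (S i) (S n) - s i (S n))) n =
                H n - H 0%nat).
    { rewrite <- zsum_telescope, <- zsum_sub. apply zsum_ext. intros i Hi.
      apply (secant_square N); trivial. lia. }
    unfold H in T. rewrite !Hturn. rewrite side_S in *. lia. }
  assert (HW : forall n, (S n < N)%nat ->
    W n = turn P 0%nat + turn P n - 2 * zsum (turn P) (S n)).
  { induction n as [|n IH]; intros Hn;
      [change (W 0%nat) with 0; simpl zsum; lia|].
    rewrite step, IH by lia.
    rewrite (proj1 (Hs0 (S n) ltac:(lia))), (proj1 (Hs0 (S (S n)) ltac:(lia))).
    simpl zsum. lia. }
  destruct N as [|[|n]]; [lia|discriminate|].
  specialize (step n ltac:(lia)). specialize (HW n ltac:(lia)).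
  (* The final point is the leftmost point again. Every secant to it goes left, except the
     degenerate one from point 0, whose sign is 0; so only the term for [i = 0] survives. *)
  assert (HWN : W (S n) = -1).
  { unfold W. rewrite zsum_S.
    rewrite (zsum_ext _ (fun _ => 0)).
    - rewrite HsN, (proj2 (Hs0 1%nat ltac:(lia))). change (side 0) with 1.
      clear. assert (E : zsum (fun _ => 0) n = 0) by (induction n; simpl; lia). lia.
    - intros i Hi. rewrite (proj2 (Hs0 (S i) ltac:(lia))).
      rewrite (proj2 (Hs0 (S (S i)) ltac:(lia))). lia. }
  rewrite HsN, (proj1 (Hs0 (S n) ltac:(lia))) in step.
  assert (Hside : side (S n) = -1).
  { unfold side. change (Nat.even n = true) in HN.
    now rewrite Nat.even_succ, <- Nat.negb_even, HN. }
  assert (H0 : turn P 0%nat = 1).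
  { rewrite Hturn, (proj1 (Hs0 1%nat ltac:(lia))). reflexivity. }
  assert (H1 : turn P (S n) = 1).
  { rewrite Hturn, (proj2 (Hs0 (S n) ltac:(lia))), Hside. reflexivity. }
  simpl zsum in *. lia.
Qed.

(** Induction on the index of the extremal point: a rotation brings it one place closer to the start
    and, containing a reflection, exchanges minimum and maximum. At index 0 a maximum is made a
    minimum by negating [P], which negates every turn. *)
Lemma turning_number_extremal N r : forall P,
  Nat.even N = true -> (r < N)%nat -> closed_meander N P ->
  (forall i, (i < N)%nat -> i <> r -> P r < P i) \/
  (forall i, (i < N)%nat -> i <> r -> P i < P r) ->
  Z.abs (zsum (turn P) N) = 2.
Proof.
  induction r as [|r IH]; intros P HN Hr HP Hext.
  - destruct Hext as [H|H].
    + rewrite (turning_number_leftmost N P); trivial. intros i Hi. apply H; lia.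
    + assert (E : zsum (turn (fun i => - P i)) N = 2).
      { apply turning_number_leftmost; trivial.
        - destruct HP as [Hc Hi Hx]. split; [lia| |].
          + intros i j Hij. specialize (Hi i j Hij). lia.
          + intros i j Hij Hp. specialize (Hx i j Hij Hp). unfold crossZ in *. lia.
        - intros i Hi. specialize (H i ltac:(lia) ltac:(lia)). lia. }
      rewrite (zsum_ext _ (fun i => - turn P i)), zsum_opp in E; [lia|].
      intros i _. unfold turn.
      replace (- P (S i) - - P i) with (- (P (S i) - P i)) by lia.
      rewrite Z.sgn_opp. lia.
  - assert (Hc := cm_closed _ _ HP).
    rewrite <- zsum_turn_rot by assumption.
    apply IH; trivial; [lia|apply rot_meander; trivial; lia|].
    unfold rot. destruct (Nat.eqb_spec r N); [lia|].
    destruct Hext as [H|H]; [right|left]; intros i Hi Hne;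
      (destruct (Nat.eqb_spec i N); [lia|]);
      (destruct (Nat.eq_dec (S i) N) as [E|E];
        [rewrite E, Hc; specialize (H 0%nat); lia | specialize (H (S i)); lia]).
Qed.

Lemma exists_min (P : nat -> Z) (N : nat) : (0 < N)%nat ->
  exists r, (r < N)%nat /\ forall i, (i < N)%nat -> P r <= P i.
Proof.
  induction N as [|[|n] IH]; intros HN; [lia| |].
  - exists 0%nat. split; [lia|]. intros i Hi. replace i with 0%nat by lia. lia.
  - destruct IH as (r & Hr & H); [lia|].
    destruct (Z.le_gt_cases (P r) (P (S n))) as [L|L].
    + exists r. split; [lia|]. intros i Hi.
      destruct (Nat.eq_dec i (S n)) as [->|]; [trivial|apply H; lia].
    + exists (S n). split; [lia|]. intros i Hi.
      destruct (Nat.eq_dec i (S n)) as [->|]; [lia|].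
      specialize (H i ltac:(lia)). lia.
Qed.

Lemma turning_number N P :
  Nat.even N = true -> (0 < N)%nat -> closed_meander N P ->
  Z.abs (zsum (turn P) N) = 2.
Proof.
  intros HN HN0 HP. destruct (exists_min P N HN0) as (r & Hr & Hmin).
  apply (turning_number_extremal N r); trivial. left. intros i Hi Hne.
  specialize (Hmin i Hi). destruct (Nat.lt_total i r) as [L|[L|L]]; [|lia|].
  - assert (D := cm_inj _ _ HP i r). lia.
  - assert (D := cm_inj _ _ HP r i). lia.
Qed.

(** * Realizing sequences of half turns *)

Definition realizable (l : list Z) : Prop :=
  exists P, closed_meander (length l) P /\
    forall i, (i < length l)%nat -> turn P i = nth i l 0.

Lemma realizable_rot1 a l : Nat.even (length (a :: l)) = true ->
  realizable (a :: l) -> realizable (l ++ [a]).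
Proof.
  intros Hev (P & HP & Ht).
  assert (EL : length (l ++ [a]) = length (a :: l)) by (rewrite length_app; simpl; lia).
  exists (rot (length (a :: l)) P). rewrite EL. split.
  - apply rot_meander; trivial. simpl; lia.
  - intros i Hi. simpl in Hi. destruct (Nat.eq_dec i (length l)) as [->|Hne].
    + simpl length. rewrite turn_rot_last; trivial; [|apply (cm_closed _ _ HP)].
      rewrite Ht by (simpl; lia). rewrite app_nth2, Nat.sub_diag by lia. reflexivity.
    + rewrite turn_rot by (simpl; lia). rewrite Ht by (simpl; lia).
      rewrite app_nth1 by lia. reflexivity.
Qed.

(** Carries a pair that was inserted at the front to its place inside the list. Even length keeps
    the sides alternating across the seam. *)
Lemma realizable_rot u : forall v, Nat.even (length (u ++ v)) = true ->
  realizable (u ++ v) -> realizable (v ++ u).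
Proof.
  induction u as [|a u IH]; intros v Hev H; [now rewrite app_nil_r|].
  replace (v ++ a :: u) with ((v ++ [a]) ++ u) by now rewrite <- app_assoc.
  apply IH; rewrite app_assoc.
  - rewrite length_app, Nat.add_comm. exact Hev.
  - now apply realizable_rot1.
Qed.

(* Two consecutive half turns in opposite directions are inserted right beside
   the first point. *)
Lemma realizable_insert a l :
  a = 1 \/ a = -1 -> Nat.even (length l) = true -> l <> [] ->
  realizable l -> realizable (a :: - a :: l).
Proof.
  intros Ha Hev Hl (P & [Hc Hi Hx] & Ht).
  set (N := length l) in *.
  assert (HN : (2 <= N)%nat).
  { unfold N in *. destruct l as [|? [|]]; simpl in *; [congruence|discriminate|lia]. }
  (* The factor 3 keeps all other points at distance at least 3 from [3 * P 0], so nothing lies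
     between it and the new points at offsets [a] and [2 * a]. The curve starts at [3 * P 0], moves
     twice in the direction of [a], first above and then below the line, which gives the turns [a]
     and [- a], and then continues to [3 * P 1]. *)
  set (Q := fun i => match i with
    | 0%nat => 3 * P 0%nat | 1%nat => 3 * P 0%nat + a | 2%nat => 3 * P 0%nat + 2 * a
    | S (S i) => 3 * P i end).
  assert (HQ : forall i, (0 < i)%nat -> Q (S (S i)) = 3 * P i).
  { intros [|i] H; [lia|reflexivity]. }
  assert (HP0 : forall i, (0 < i < N)%nat -> P i <> P 0%nat).
  { intros i H. apply not_eq_sym, Hi. lia. }
  assert (Hodd : forall i, Nat.even i = true -> (i < N)%nat -> (S i < N)%nat).
  { intros i H1 H2. destruct (Nat.eq_dec (S i) N) as [E|]; [|lia].
    rewrite <- E, Nat.even_succ, <- Nat.negb_even, H1 in Hev. discriminate. }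
  exists Q. change (length (a :: - a :: l)) with (S (S N)). split; [split|].
  - rewrite HQ, Hc by lia. reflexivity.
  - intros [|[|[|i]]] [|[|[|j]]] Hij; try lia;
      repeat match goal with |- context [Q (S (S (S ?k)))] =>
        rewrite (HQ (S k)) by lia end;
      try (unfold Q; lia); try (specialize (HP0 (S j)); unfold Q; lia).
    specialize (Hi (S i) (S j)). lia.
  - intros i j Hij Hp.
    destruct i as [|[|[|i]]].
    + destruct j as [|[|j]]; [lia|discriminate Hp|].
      simpl in Hp. symmetry in Hp. specialize (Hodd j Hp ltac:(lia)).
      rewrite (HQ (S j)) by lia. destruct j as [|j];
        [|rewrite (HQ (S j)) by lia]; unfold crossZ, Q; lia.
    + destruct j as [|[|[|j]]]; [lia|lia|discriminate Hp|].
      rewrite (HQ (S (S j))), (HQ (S j)) by lia. unfold crossZ, Q; lia.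
    + destruct j as [|[|[|[|j]]]]; [lia|lia|lia|discriminate Hp|].
      simpl in Hp. symmetry in Hp.
      specialize (Hodd (S (S j)) Hp ltac:(lia)).
      rewrite (HQ (S (S (S j)))), (HQ (S (S j))), (HQ 1%nat) by lia. unfold Q.
      specialize (Hx 0%nat (S (S j)) ltac:(lia) (eq_sym Hp)).
      assert (D1 := HP0 1%nat ltac:(lia)). assert (D2 := HP0 (S (S j)) ltac:(lia)).
      assert (D3 := HP0 (S (S (S j))) ltac:(lia)).
      unfold crossZ in *. lia.
    + destruct j as [|[|[|j]]]; [lia|lia|lia|].
      rewrite (HQ (S i)), (HQ (S (S i))), (HQ (S j)), (HQ (S (S j))) by lia.
      specialize (Hx (S i) (S j) ltac:(lia) Hp). unfold crossZ in *. lia.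
  - intros i Hil. destruct i as [|[|[|i]]].
    + unfold turn, Q. replace (3 * P 0%nat + a - 3 * P 0%nat) with a by lia.
      destruct Ha as [-> | ->]; reflexivity.
    + unfold turn, Q.
      replace (3 * P 0%nat + 2 * a - (3 * P 0%nat + a)) with a by lia.
      destruct Ha as [-> | ->]; reflexivity.
    + change (nth 2 (a :: - a :: l) 0) with (nth 0 l 0).
      rewrite <- Ht by lia. unfold turn. rewrite (HQ 1%nat) by lia.
      change (side 2) with (side 0). f_equal. unfold Q.
      specialize (HP0 1%nat ltac:(lia)).
      destruct (Z.sgn_spec (P 1%nat - P 0%nat)) as [[H ->]|[[H ->]|[H ->]]];
        [apply Z.sgn_pos|lia|apply Z.sgn_neg]; lia.
    + change (nth (S (S (S i))) (a :: - a :: l) 0) with (nth (S i) l 0).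
      rewrite <- Ht by lia. unfold turn. rewrite (HQ (S i)), (HQ (S (S i))) by lia.
      change (side (S (S (S i)))) with (side (S i)). f_equal.
      replace (3 * P (S (S i)) - 3 * P (S i)) with (3 * (P (S (S i)) - P (S i))) by lia.
      rewrite Z.sgn_mul. lia.
Qed.

Definition sum_list (l : list Z) : Z := fold_right Z.add 0 l.

Lemma sum_list_app l1 l2 : sum_list (l1 ++ l2) = sum_list l1 + sum_list l2.
Proof. induction l1; simpl; lia. Qed.

Lemma constant_or_cancelling l : forall a,
  (forall x, In x (a :: l) -> x = 1 \/ x = -1) ->
  (sum_list l = a * Z.of_nat (length l)) \/
  exists l1 b l2, a :: l = l1 ++ b :: - b :: l2.
Proof.
  induction l as [|b l IH]; intros a Ha; [left; simpl; lia|].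
  assert (Ha' := Ha a (or_introl eq_refl)).
  assert (Hb := Ha b (or_intror (or_introl eq_refl))).
  destruct (Z.eq_dec b a) as [->|Hne].
  - destruct (IH a) as [E|(l1 & c & l2 & E)].
    + intros x Hx. apply Ha. now right.
    + left. simpl length. simpl sum_list. lia.
    + right. exists (a :: l1), c, l2. simpl. now rewrite E.
  - right. exists [], a, l. simpl. do 2 f_equal. lia.
Qed.

Lemma realizable_of_sum n : forall l,
  length l = (2 * S n)%nat -> (forall x, In x l -> x = 1 \/ x = -1) ->
  Z.abs (sum_list l) = 2 -> realizable l.
Proof.
  induction n as [|n IH]; intros l Hlen Hl Hsum.
  - destruct l as [|a [|b [|]]]; simpl in Hlen; try lia.
    assert (Ha : a = 1 \/ a = -1) by (apply Hl; simpl; auto).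
    assert (Hb : b = a).
    { assert (b = 1 \/ b = -1) by (apply Hl; simpl; auto).
      change (Z.abs (a + (b + 0)) = 2) in Hsum. lia. }
    (* A circle through 0 and [a]: out above the line, back below it. *)
    subst b. exists (fun i => if (i =? 1)%nat then a else 0). split; [split|].
    + reflexivity.
    + intros i j Hij. simpl in Hij. replace i with 0%nat by lia. replace j with 1%nat by lia.
      simpl. lia.
    + intros i j Hij. simpl in Hij. replace i with 0%nat by lia. replace j with 1%nat by lia.
      discriminate.
    + intros i Hi. simpl in Hi. destruct i as [|[|i]]; [| |lia];
        destruct Ha as [-> | ->]; reflexivity.
  - destruct l as [|a l]; [simpl in Hlen; lia|].
    destruct (constant_or_cancelling l a Hl) as [E|(l1 & b & l2 & E)].
    (* Without a cancelling pair the sum of the whole list is [a] times its length, of absolute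
       value at least 4. *)
    + assert (Ha := Hl a (or_introl eq_refl)). simpl in Hlen.
      change (Z.abs (a + sum_list l) = 2) in Hsum. nia.
    + rewrite E in *. clear a l E.
      assert (Hlen' : length (l2 ++ l1) = (2 * S n)%nat)
        by (rewrite length_app in *; simpl in *; lia).
      change (b :: - b :: l2) with ((b :: - b :: nil) ++ l2).
      apply (realizable_rot (b :: - b :: l2)).
      { change (Nat.even (length (l2 ++ l1)) = true). rewrite Hlen'.
        apply Nat.even_even. }
      apply (realizable_insert b (l2 ++ l1)).
      * apply Hl, in_or_app. right. now left.
      * rewrite Hlen'. apply Nat.even_even.
      * intros H. rewrite H in Hlen'. simpl in Hlen'. lia.
      * apply IH; trivial.
        -- intros x Hx. apply Hl. rewrite in_app_iff in *. simpl. tauto.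
        -- rewrite sum_list_app in *. 
           change (sum_list (b :: - b :: l2)) with (b + (- b + sum_list l2)) in Hsum.
           lia.
Qed.

Local Close Scope Z_scope.

(** * Embeddings and alternating cycles *)

(* A matching is handled through the involution exchanging matched vertices,
   whose fixed points are the unmatched vertices. *)
Fixpoint mate (E : list edge) (x : nat) : nat :=
  match E with
  | [] => x
  | (u, v) :: E => if x =? u then v else if x =? v then u else mate E x
  end.

Definition is_tail (E : list edge) (x : nat) : bool := existsb (fun e => x =? fst e) E.

Definition is_head (E : list edge) (x : nat) : bool := existsb (fun e => x =? snd e) E.

(** [out] is constrained at matched vertices only, so tail marks and negated head marks can both
    serve. *)
Record represents (E : list edge) (m : nat -> nat) (out : nat -> bool) : Prop := {
  rep_invol : forall x, m (m x) = x;
  rep_out : forall x, m x <> x -> out (m x) = negb (out x);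
  rep_edge : forall u v, In (u, v) E <-> v = m u /\ m u <> u /\ out u = true }.

Lemma is_tail_spec E x : is_tail E x = true <-> exists v, In (x, v) E.
Proof.
  unfold is_tail. rewrite existsb_exists. split.
  - intros ([u v] & H & Hx). apply Nat.eqb_eq in Hx. simpl in Hx. subst. eauto.
  - intros [v H]. exists (x, v). split; [trivial|apply Nat.eqb_refl].
Qed.

Lemma is_head_spec E x : is_head E x = true <-> exists u, In (u, x) E.
Proof.
  unfold is_head. rewrite existsb_exists. split.
  - intros ([u v] & H & Hx). apply Nat.eqb_eq in Hx. simpl in Hx. subst. eauto.
  - intros [u H]. exists (u, x). split; [trivial|apply Nat.eqb_refl].
Qed.

Lemma mate_cases E x :
  In (x, mate E x) E \/ In (mate E x, x) E \/
  (mate E x = x /\ forall y, ~ In (x, y) E /\ ~ In (y, x) E).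
Proof.
  induction E as [|[u v] E IH]; simpl; [right; right; tauto|].
  destruct (Nat.eqb_spec x u) as [->|Hu]; [tauto|].
  destruct (Nat.eqb_spec x v) as [->|Hv]; [tauto|].
  destruct IH as [H|[H|[H1 H2]]]; [tauto|tauto|]. right; right. split; [trivial|].
  intros y. specialize (H2 y). split; intros [E'|E']; try tauto; injection E'; lia.
Qed.

Lemma matching_tail_unique E u v v' :
  is_matching E -> In (u, v) E -> In (u, v') E -> v = v'.
Proof.
  intros (_ & _ & H) H1 H2. destruct (Nat.eq_dec v v') as [|N]; [trivial|].
  destruct (H u v u v' H1 H2); congruence.
Qed.

Lemma matching_head_unique E u u' v :
  is_matching E -> In (u, v) E -> In (u', v) E -> u = u'.
Proof.
  intros (_ & _ & H) H1 H2. destruct (Nat.eq_dec u u') as [|N]; [trivial|].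
  destruct (H u v u' v H1 H2) as (_ & _ & _ & D); congruence.
Qed.

Lemma matching_tail_not_head E u v w :
  is_matching E -> In (u, v) E -> In (w, u) E -> False.
Proof.
  intros (_ & L & H) H1 H2. destruct (Nat.eq_dec u w) as [->|N].
  - now apply (L w w).
  - destruct (H u v w u H1 H2) as (_ & D & _); congruence.
Qed.

Lemma mate_edge E u v :
  is_matching E -> In (u, v) E -> mate E u = v /\ mate E v = u.
Proof.
  intros M H. split.
  - destruct (mate_cases E u) as [C|[C|[_ C]]].
    + eapply matching_tail_unique; eauto.
    + destruct (matching_tail_not_head E _ _ _ M H C).
    + now destruct (C v).
  - destruct (mate_cases E v) as [C|[C|[_ C]]].
    + destruct (matching_tail_not_head E _ _ _ M C H).
    + eapply matching_head_unique; eauto.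
    + now destruct (C u).
Qed.

Lemma represents_tail E : is_matching E -> represents E (mate E) (is_tail E).
Proof.
  intros M. split.
  - intros x. destruct (mate_cases E x) as [C|[C|[C _]]].
    + now apply mate_edge in C.
    + now apply mate_edge in C.
    + now rewrite !C.
  - intros x Hx. destruct (mate_cases E x) as [C|[C|[C _]]]; [| |congruence].
    + rewrite (proj2 (is_tail_spec E x)) by eauto. apply not_true_iff_false.
      rewrite is_tail_spec. intros [v D].
      exact (matching_tail_not_head E _ _ _ M D C).
    + rewrite (proj2 (is_tail_spec E (mate E x))) by eauto. symmetry.
      apply negb_true_iff, not_true_iff_false.
      rewrite is_tail_spec. intros [v D].
      exact (matching_tail_not_head E _ _ _ M D C).
  - intros u v. split.
    + intros H. assert (H' := mate_edge E u v M H). rewrite is_tail_spec.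
      split; [easy|split; [|eauto]]. rewrite (proj1 H').
      destruct M as (_ & L & _). apply not_eq_sym. eauto.
    + intros (-> & _ & T). apply is_tail_spec in T as [v H].
      now rewrite (proj1 (mate_edge E u v M H)).
Qed.

(** Below the line a half turn is clockwise when it goes left, that is, when the edge is entered at
    its head. The machine therefore keeps head marks for the second page, so that both mark tables
    flag clockwise half turns. *)
Lemma represents_head E :
  is_matching E -> represents E (mate E) (fun x => negb (is_head E x)).
Proof.
  intros M. destruct (represents_tail E M) as [HI HO HE].
  assert (ht : forall x, mate E x <> x -> negb (is_head E x) = is_tail E x).
  { intros x Hx. destruct (mate_cases E x) as [C|[C|[C _]]]; [| |congruence].
    - rewrite (proj2 (is_tail_spec E x)) by eauto. apply negb_true_iff, not_true_iff_false.
      rewrite is_head_spec. intros [w D].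
      exact (matching_tail_not_head E _ _ _ M C D).
    - rewrite (proj2 (is_head_spec E x)) by eauto. symmetry. apply not_true_iff_false.
      rewrite is_tail_spec. intros [w D].
      exact (matching_tail_not_head E _ _ _ M D C). }
  split; [exact HI| |].
  - intros x Hx. rewrite !ht by (rewrite ?HI; auto). auto.
  - intros u v. rewrite HE. split; intros (A & B & C); rewrite ?ht in * by auto; auto.
Qed.

(** Writing to a table lets the last edge prevail, whereas [mate] lets the first edge of the list
    decide. The tables built by the machine hence describe the reversed edge lists. *)
Lemma is_matching_rev E : is_matching E -> is_matching (rev E).
Proof.
  intros (A & B & C). split; [now apply NoDup_rev|]. split.
  - intros u v H. apply in_rev in H. auto.
  - intros u1 v1 u2 v2 H1 H2. apply in_rev in H1, H2. auto.
Qed.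

Lemma represents_rev E m out : represents (rev E) m out -> represents E m out.
Proof.
  intros [A B C]. split; trivial. intros u v. rewrite <- C. apply in_rev.
Qed.

(** * Embeddings as integer positions *)

Record page_embeds (S : nat -> Prop) (m : nat -> nat) (out : nat -> bool)
    (p : nat -> Z) : Prop := {
  pe_mono : forall x, S x -> S (m x) -> m x <> x -> out x = true -> (p x < p (m x))%Z;
  pe_nocross : forall x y, S x -> S (m x) -> S y -> S (m y) ->
    m x <> x -> m y <> y -> y <> x -> y <> m x ->
    ~ crossZ (p x) (p (m x)) (p y) (p (m y)) }.

(** Positions are arbitrary distinct integers and [S] is an arbitrary vertex set, edges leaving it
    being ignored. Vertices and cycles can then be taken out and put back without renumbering. *)
Definition embeds (S : nat -> Prop) (m1 : nat -> nat) (o1 : nat -> bool)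
    (m2 : nat -> nat) (o2 : nat -> bool) (p : nat -> Z) : Prop :=
  (forall x y, S x -> S y -> p x = p y -> x = y) /\
  page_embeds S m1 o1 p /\ page_embeds S m2 o2 p.

Lemma page_embeds_of_no_crossing n E m out pi :
  represents E m out -> topological pi E -> no_crossing pi E ->
  page_embeds (fun x => x < n) m out (fun x => Z.of_nat (pi x)).
Proof.
  intros [HI HO HE] HT HX.
  assert (edge_of : forall x, m x <> x -> In (x, m x) E \/ In (m x, x) E).
  { intros x Hx. destruct (out x) eqn:O.
    - left. apply HE. auto.
    - right. apply HE. rewrite HI, HO, O; auto. }
  split.
  - intros x _ _ Hx Ho. assert (In (x, m x) E) by (apply HE; auto).
    specialize (HT _ _ H). lia.
  - intros x y _ _ _ _ Hx Hy N1 N2 HC.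
    assert (key : forall e f, In e E -> In f E ->
      (e = (x, m x) \/ e = (m x, x)) -> (f = (y, m y) \/ f = (m y, y)) -> False).
    { intros e f He Hf Ee Ef. apply (HX e f He Hf).
      - intros <-. destruct Ee, Ef; subst; congruence.
      - unfold cross, crossZ in *.
        destruct Ee as [-> | ->], Ef as [-> | ->]; simpl; lia. }
    destruct (edge_of x Hx) as [A|A], (edge_of y Hy) as [B|B];
      apply (key _ _ A B); auto.
Qed.

Lemma filter_length_lt (f g : nat -> bool) l a :
  (forall x, f x = true -> g x = true) -> In a l -> f a = false -> g a = true ->
  length (filter f l) < length (filter g l).
Proof.
  intros Hfg Ha Hf Hg.
  assert (le : forall l, length (filter f l) <= length (filter g l)).
  { induction l0 as [|b l0 IH]; simpl; [lia|].
    specialize (Hfg b). destruct (f b), (g b); simpl; lia. }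
  induction l as [|b l IH]; simpl in *; [easy|].
  destruct Ha as [->|Ha].
  - rewrite Hf, Hg. simpl. specialize (le l). lia.
  - specialize (IH Ha). specialize (Hfg b).
    destruct (f b), (g b); simpl; lia.
Qed.

(** Compresses injective integer positions into [0, ..., n - 1] while keeping their order, as
    required of a linear ordering. *)
Definition rank (n : nat) (p : nat -> Z) (v : nat) : nat :=
  length (filter (fun y => (p y <? p v)%Z) (seq 0 n)).

Lemma rank_lt n p u v : u < n -> (p u < p v)%Z -> rank n p u < rank n p v.
Proof.
  intros Hu Hp. apply (filter_length_lt _ _ _ u).
  - intros x Hx. apply Z.ltb_lt in Hx. apply Z.ltb_lt. lia.
  - apply in_seq. lia.
  - apply Z.ltb_irrefl.
  - now apply Z.ltb_lt.
Qed.

Lemma rank_lt_n n p v : v < n -> rank n p v < n.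
Proof.
  intros Hv. unfold rank.
  assert (H := filter_length_le (fun _ => true) (seq 0 n)). rewrite length_seq in H.
  eapply Nat.lt_le_trans; [|exact H].
  apply (filter_length_lt _ _ _ v); auto; [apply in_seq; lia|apply Z.ltb_irrefl].
Qed.

Lemma no_crossing_of_page_embeds n E m out p :
  (forall x y, x < n -> y < n -> p x = p y -> x = y) ->
  edges_in_range n E -> represents E m out ->
  page_embeds (fun x => x < n) m out p ->
  topological (rank n p) E /\ no_crossing (rank n p) E.
Proof.
  intros Hinj HR [HI HO HE] [HM HX]. split.
  - intros u v H. assert (R := HR u v H). apply HE in H as (-> & Hu & Ho).
    apply rank_lt; [easy|]. apply HM; easy.
  - intros [u v] [u' v'] H H' N HC.
    assert (R := HR u v H). assert (R' := HR u' v' H').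
    apply HE in H as (-> & Hu & Ho). apply HE in H' as (-> & Hu' & Ho').
    assert (N1 : u' <> u) by congruence.
    assert (N2 : u' <> m u).
    { intros ->. rewrite HO, Ho in Ho'; [discriminate|trivial]. }
    apply (HX u u'); try easy.
    assert (refl : forall x y, x < n -> y < n ->
      rank n p x < rank n p y -> (p x < p y)%Z).
    { intros x y Hx Hy L. destruct (Z.lt_trichotomy (p x) (p y)) as [L'|[L'|L']].
      - trivial.
      - rewrite (Hinj x y) in L by trivial. lia.
      - apply (rank_lt n) in L'; trivial. lia. }
    assert (M : (p u < p (m u))%Z) by (apply HM; easy).
    assert (M' : (p u' < p (m u'))%Z) by (apply HM; easy).
    assert (L := rank_lt n p u (m u) (proj1 R) M).
    assert (L' := rank_lt n p u' (m u') (proj1 R') M').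
    unfold cross in HC. simpl in HC. unfold crossZ.
    rewrite !Nat.min_l, !Nat.max_r in HC by lia.
    rewrite !Z.min_l, !Z.max_r by lia.
    destruct HC as [(A1 & A2 & A3)|(A1 & A2 & A3)]; [left|right];
      (split; [|split]); apply refl; easy.
Qed.

Lemma embeddable_iff n E1 E2 m1 o1 m2 o2 :
  edges_in_range n (E1 ++ E2) -> represents E1 m1 o1 -> represents E2 m2 o2 ->
  (upward_mp2_book_embeddable n E1 E2 <->
   exists p, embeds (fun x => x < n) m1 o1 m2 o2 p).
Proof.
  intros HR H1 H2.
  assert (HR1 : edges_in_range n E1) by (intros u v H; apply HR, in_or_app; auto).
  assert (HR2 : edges_in_range n E2) by (intros u v H; apply HR, in_or_app; auto).
  split.
  - intros (pi & (_ & Hinj) & HT & HX1 & HX2).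
    exists (fun x => Z.of_nat (pi x)). split; [|split].
    + intros x y Hx Hy H. apply Hinj; trivial. lia.
    + apply page_embeds_of_no_crossing with (E := E1); trivial.
      intros u v H. apply HT, in_or_app. auto.
    + apply page_embeds_of_no_crossing with (E := E2); trivial.
      intros u v H. apply HT, in_or_app. auto.
  - intros (p & Hinj & HP1 & HP2).
    destruct (no_crossing_of_page_embeds n E1 m1 o1 p) as [T1 X1]; trivial.
    destruct (no_crossing_of_page_embeds n E2 m2 o2 p) as [T2 X2]; trivial.
    exists (rank n p). split; [split|split; [|auto]].
    + intros v Hv. now apply rank_lt_n.
    + intros u v Hu Hv H. apply Hinj; trivial.
      destruct (Z.lt_trichotomy (p u) (p v)) as [L|[L|L]]; trivial;
        apply (rank_lt n) in L; trivial; lia.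
    + intros u v H. apply in_app_or in H as [H|H]; auto.
Qed.

(** * Orbits and the closed curve of a cycle *)

Definition nxt (m1 m2 : nat -> nat) (x : nat) : nat := m2 (m1 x).

Definition period (m1 m2 : nat -> nat) (x k : nat) : Prop :=
  0 < k /\ Nat.iter k (nxt m1 m2) x = x /\
  forall i, 0 < i < k -> Nat.iter i (nxt m1 m2) x <> x.

(** A vertex on a path has a periodic orbit too: at an end of the path one of the involutions fixes
    the vertex and the walk turns back. This condition singles out the orbits that lie on cycles. *)
Definition unmatched_free (m1 m2 : nat -> nat) (x k : nat) : Prop :=
  forall i, i < k -> let y := Nat.iter i (nxt m1 m2) x in
  m1 y <> y /\ m2 (m1 y) <> m1 y.

Definition dir (b : bool) : Z := if b then 1%Z else (-1)%Z.

(* Half turns made on the first-page edge from [y] to [m1 y] and on the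
   second-page edge from [m1 y] to [m2 (m1 y)]. *)
Definition weight (m1 : nat -> nat) (o1 o2 : nat -> bool) (y : nat) : Z :=
  (dir (o1 y) - dir (o2 (m1 y)))%Z.

(** Vacuous for paths. On a cycle it asks for turning number 1 or -1, a full turn being two half
    turns. *)
Definition good (m1 : nat -> nat) (o1 : nat -> bool) (m2 : nat -> nat)
    (o2 : nat -> bool) (x : nat) : Prop :=
  forall k, period m1 m2 x k -> unmatched_free m1 m2 x k ->
  Z.abs (zsum (fun i => weight m1 o1 o2 (Nat.iter i (nxt m1 m2) x)) k) = 2%Z.

(** The orbit under [nxt] contains only every other vertex of a cycle; this sequence lists all of
    them, with the arcs leaving even indices on the first page. *)
Fixpoint curve (m1 m2 : nat -> nat) (x i : nat) : nat :=
  match i with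
  | 0 => x
  | S i => (if Nat.even i then m1 else m2) (curve m1 m2 x i)
  end.

Definition involutive (m : nat -> nat) : Prop := forall x, m (m x) = x.

Lemma iter_add_nxt m1 m2 i j x :
  Nat.iter (i + j) (nxt m1 m2) x = Nat.iter i (nxt m1 m2) (Nat.iter j (nxt m1 m2) x).
Proof. apply Nat.iter_add. Qed.

Lemma curve_even m1 m2 x i : curve m1 m2 x (2 * i) = Nat.iter i (nxt m1 m2) x.
Proof.
  induction i as [|i IH]; [reflexivity|].
  replace (2 * S i) with (S (S (2 * i))) by lia. cbn [curve].
  rewrite Nat.even_succ, <- Nat.negb_even, Nat.even_even. simpl negb. cbv iota.
  rewrite IH. reflexivity.
Qed.

Lemma curve_odd m1 m2 x i : curve m1 m2 x (S (2 * i)) = m1 (Nat.iter i (nxt m1 m2) x).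
Proof. cbn [curve]. rewrite Nat.even_even. now rewrite curve_even. Qed.

Lemma even_or_odd i : exists a, i = 2 * a \/ i = S (2 * a).
Proof. destruct (Nat.Even_or_Odd i) as [[a ->]|[a ->]]; exists a; lia. Qed.

Lemma nxt_inj m1 m2 : involutive m1 -> involutive m2 -> forall x y,
  nxt m1 m2 x = nxt m1 m2 y -> x = y.
Proof.
  intros I1 I2 x y H. unfold nxt in H.
  now rewrite <- (I1 x), <- (I2 (m1 x)), H, I2, I1.
Qed.

Lemma nxt_iter_inj m1 m2 : involutive m1 -> involutive m2 -> forall i x y,
  Nat.iter i (nxt m1 m2) x = Nat.iter i (nxt m1 m2) y -> x = y.
Proof.
  intros I1 I2 i. induction i as [|i IH]; intros x y H; [exact H|].
  apply IH. now apply (nxt_inj m1 m2).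
Qed.

Lemma iter_nxt_distinct m1 m2 x k : involutive m1 -> involutive m2 ->
  period m1 m2 x k -> forall i j, i < j < k ->
  Nat.iter i (nxt m1 m2) x <> Nat.iter j (nxt m1 m2) x.
Proof.
  intros I1 I2 (_ & _ & Hk) i j Hij H.
  replace j with (i + (j - i)) in H by lia. rewrite iter_add_nxt in H.
  apply nxt_iter_inj in H; trivial. apply (Hk (j - i)); [lia|auto].
Qed.

(* [m1] reverses the cycle: if it maps one vertex of the orbit to another, then
   halfway between the two there is an unmatched vertex. *)
Lemma reflection_free m1 m2 x k : involutive m1 -> involutive m2 ->
  unmatched_free m1 m2 x k -> forall d b, b + d < k ->
  m1 (Nat.iter b (nxt m1 m2) x) <> Nat.iter (b + d) (nxt m1 m2) x.
Proof.
  intros I1 I2 HF d. induction d as [d IH] using lt_wf_ind. intros b Hb H.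
  destruct d as [|[|d]].
  - rewrite Nat.add_0_r in H. now destruct (HF b ltac:(lia)).
  - rewrite Nat.add_1_r in H. destruct (HF b ltac:(lia)) as [_ F]. now apply F.
  - apply (IH d ltac:(lia) (S b)); [lia|].
    replace (b + S (S d)) with (S (S b + d)) in H by lia. simpl Nat.iter in H |- *.
    unfold nxt at 1. rewrite H. unfold nxt at 1. now rewrite I2, I1.
Qed.

(** Two indices of equal parity are separated by minimality of the period, after cancelling [m1] in
    the odd case. For indices of different parity a coincidence would make [m1] map one orbit vertex
    to another, which [reflection_free] excludes. *)
Lemma curve_distinct m1 m2 x k : involutive m1 -> involutive m2 ->
  period m1 m2 x k -> unmatched_free m1 m2 x k ->
  forall i j, i < j < 2 * k -> curve m1 m2 x i <> curve m1 m2 x j.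
Proof.
  intros I1 I2 HP HF i j Hij.
  assert (key : forall a b, a < k -> b < k ->
    m1 (Nat.iter a (nxt m1 m2) x) <> Nat.iter b (nxt m1 m2) x).
  { intros a b Ha Hb H. destruct (Nat.le_ge_cases a b) as [L|L].
    - apply (reflection_free m1 m2 x k I1 I2 HF (b - a) a); [lia|].
      now replace (a + (b - a)) with b by lia.
    - apply (reflection_free m1 m2 x k I1 I2 HF (a - b) b); [lia|].
      replace (b + (a - b)) with a by lia. now rewrite <- H, I1. }
  destruct (even_or_odd i) as [a [-> | ->]], (even_or_odd j) as [b [-> | ->]];
    rewrite ?curve_even, ?curve_odd.
  - apply (iter_nxt_distinct m1 m2 x k); trivial. lia.
  - apply not_eq_sym, key; lia.
  - apply key; lia.
  - intros H. apply (f_equal m1) in H. rewrite !I1 in H. revert H.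
    apply (iter_nxt_distinct m1 m2 x k); trivial. lia.
Qed.

Lemma curve_closed m1 m2 x k : period m1 m2 x k -> curve m1 m2 x (2 * k) = x.
Proof. rewrite curve_even. now intros (_ & H & _). Qed.

Definition page (b : bool) {A : Type} (u v : A) : A := if b then u else v.

Definition curve_out (m1 : nat -> nat) (o1 : nat -> bool) (m2 : nat -> nat)
    (o2 : nat -> bool) (x i : nat) : bool :=
  page (Nat.even i) o1 o2 (curve m1 m2 x i).

Lemma zsum_curve m1 o1 m2 o2 x k :
  zsum (fun i => side i * dir (curve_out m1 o1 m2 o2 x i))%Z (2 * k) =
  zsum (fun i => weight m1 o1 o2 (Nat.iter i (nxt m1 m2) x)) k.
Proof.
  induction k as [|k IH]; [reflexivity|].
  replace (2 * S k) with (S (S (2 * k))) by lia. cbn [zsum].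
  rewrite IH. unfold weight, curve_out.
  rewrite Nat.even_succ, <- Nat.negb_even, Nat.even_even.
  rewrite curve_even, curve_odd, side_S.
  unfold side. rewrite Nat.even_even. unfold page. change (negb true) with false. cbv iota. lia.
Qed.

Lemma curve_succ m1 m2 x i :
  curve m1 m2 x (S i) = page (Nat.even i) m1 m2 (curve m1 m2 x i).
Proof. unfold page. cbn [curve]. now destruct (Nat.even i). Qed.

Lemma good_of_embeds S m1 o1 m2 o2 p x :
  involutive m1 -> involutive m2 ->
  (forall y, m1 y <> y -> o1 (m1 y) = negb (o1 y)) ->
  (forall y, m2 y <> y -> o2 (m2 y) = negb (o2 y)) ->
  (forall y, S y -> S (m1 y)) -> (forall y, S y -> S (m2 y)) -> S x ->
  embeds S m1 o1 m2 o2 p -> good m1 o1 m2 o2 x.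
Proof.
  intros I1 I2 O1 O2 S1 S2 Hx (Hinj & HE1 & HE2) k HP HF.
  set (c := curve m1 m2 x).
  assert (HS : forall i, S (c i)).
  { induction i as [|i IH]; [exact Hx|]. unfold c. cbn [curve].
    destruct (Nat.even i); auto. }
  assert (Hk : 0 < k) by apply HP.
  assert (Hd := curve_distinct m1 m2 x k I1 I2 HP HF). fold c in Hd.
  assert (Hc : c (2 * k) = c 0) by now apply curve_closed.
  assert (Hd' : forall i, i < 2 * k -> c (Datatypes.S i) <> c i).
  { intros i Hi. destruct (Nat.eq_dec (Datatypes.S i) (2 * k)) as [E|E].
    - rewrite E, Hc. apply Hd. lia.
    - apply not_eq_sym, Hd. lia. }
  rewrite <- zsum_curve.
  rewrite (zsum_ext _ (turn (fun i => p (c i)))).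
  - apply turning_number; [apply Nat.even_even|lia|]. split.
    + now rewrite Hc.
    + intros i j Hij H. apply Hinj in H; auto. now apply (Hd i j).
    + intros i j Hij Hpar.
      assert (N1 := Hd' i ltac:(lia)). assert (N2 := Hd' j ltac:(lia)).
      assert (N3 := Hd i j Hij).
      assert (N4 : c j <> c (Datatypes.S i)).
      { destruct (Nat.eq_dec (Datatypes.S i) j) as [<-|].
        - rewrite Nat.even_succ, <- Nat.negb_even in Hpar.
          now destruct (Nat.even i).
        - apply not_eq_sym, Hd. lia. }
      assert (Si := HS (Datatypes.S i)). assert (Sj := HS (Datatypes.S j)).
      unfold c in N1, N2, N4, Si, Sj |- *. rewrite !curve_succ in *.
      fold c in N1, N2, N3, N4, Si, Sj |- *. rewrite <- Hpar in *.
      destruct (Nat.even i); simpl in *; [apply HE1|apply HE2]; auto.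
  - intros i Hi. unfold turn. f_equal. symmetry.
    assert (N1 := Hd' i Hi).
    assert (step : forall m o, page_embeds S m o p -> involutive m ->
      (forall y, m y <> y -> o (m y) = negb (o y)) ->
      (forall y, S y -> S (m y)) -> m (c i) <> c i ->
      Z.sgn (p (m (c i)) - p (c i)) = dir (o (c i))).
    { intros m o [HM _] I O HSm Hm. destruct (o (c i)) eqn:Eo; simpl.
      - specialize (HM (c i) (HS i) (HSm _ (HS i)) Hm Eo). apply Z.sgn_pos. lia.
      - specialize (HM (m (c i)) (HSm _ (HS i))). rewrite I in HM.
        specialize (HM (HS i) (not_eq_sym Hm)). rewrite O, Eo in HM by trivial.
        specialize (HM eq_refl). apply Z.sgn_neg. lia. }
    unfold curve_out. unfold c in N1 |- *. rewrite curve_succ in *. fold c in N1 |- *.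
    destruct (Nat.even i); simpl in *; auto.
Qed.

Lemma pigeonhole (g : nat -> nat) l :
  (forall i, In (g i) l) -> exists i j, i < j /\ g i = g j.
Proof.
  intros Hg.
  assert (H : forall k, NoDup (map g (seq 0 k)) \/ exists i j, i < j /\ g i = g j).
  { induction k as [|k [IH|IH]]; [left; constructor| |right; exact IH].
    destruct (in_dec Nat.eq_dec (g k) (map g (seq 0 k))) as [D|D].
    - right. apply in_map_iff in D as (i & E & Hi). apply in_seq in Hi.
      exists i, k. split; [lia|trivial].
    - left. rewrite seq_S, map_app. apply NoDup_app; trivial.
      + constructor; [easy|constructor].
      + intros a Ha [<-|[]]. now apply D. }
  destruct (H (S (length l))) as [D|D]; [|exact D]. exfalso.
  assert (L : length (map g (seq 0 (S (length l)))) <= length l).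
  { apply NoDup_incl_length; trivial. intros y Hy.
    apply in_map_iff in Hy as (i & <- & _). apply Hg. }
  rewrite length_map, length_seq in L. lia.
Qed.

(** The pigeonhole principle gives a repetition, injectivity of [nxt] cancels it to a return to the
    start, and the least return is the period. *)
Lemma period_exists m1 m2 l x : involutive m1 -> involutive m2 ->
  (forall y, In y l -> In (nxt m1 m2 y) l) -> In x l ->
  exists k, period m1 m2 x k.
Proof.
  intros I1 I2 Hl Hx.
  assert (HO : forall i, In (Nat.iter i (nxt m1 m2) x) l).
  { induction i; simpl; auto. }
  destruct (pigeonhole _ l HO) as (i & j & Hij & E).
  replace j with (i + (j - i)) in E by lia. rewrite iter_add_nxt in E.
  apply nxt_iter_inj in E; trivial.
  assert (H : exists k, 0 < k /\ Nat.iter k (nxt m1 m2) x = x)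
    by (exists (j - i); split; [lia|auto]).
  destruct H as [k H]. clear i j Hij E. revert H.
  induction k as [k IH] using lt_wf_ind. intros [Hk E].
  destruct (Exists_dec (fun i => Nat.iter i (nxt m1 m2) x = x) (seq 1 (k - 1)))
    as [D|D].
  - intros i. apply Nat.eq_dec.
  - apply Exists_exists in D as (i & Hi & Ei). apply in_seq in Hi.
    apply (IH i); [lia|split; [lia|trivial]].
  - exists k. split; [trivial|split; [trivial|]]. intros i Hi Ei. apply D.
    apply Exists_exists. exists i. split; [apply in_seq; lia|trivial].
Qed.

Lemma sum_list_map f n : sum_list (map f (seq 0 n)) = zsum f n.
Proof.
  induction n as [|n IH]; [reflexivity|].
  rewrite seq_S, map_app, sum_list_app, IH. simpl. lia.
Qed.

Lemma cycle_positions m1 o1 m2 o2 x k : 0 < k ->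
  Z.abs (zsum (fun i => weight m1 o1 o2 (Nat.iter i (nxt m1 m2) x)) k) = 2%Z ->
  exists P, closed_meander (2 * k) P /\
    forall i, i < 2 * k -> Z.sgn (P (S i) - P i) = dir (curve_out m1 o1 m2 o2 x i).
Proof.
  intros Hk Hsum. rewrite <- zsum_curve, <- sum_list_map in Hsum.
  set (f := fun i => (side i * dir (curve_out m1 o1 m2 o2 x i))%Z) in Hsum.
  destruct (realizable_of_sum (k - 1) (map f (seq 0 (2 * k)))) as (P & HP & HT); trivial.
  - rewrite length_map, length_seq. lia.
  - intros z Hz. apply in_map_iff in Hz as (i & <- & _). unfold f, side, dir.
    destruct (Nat.even i), (curve_out m1 o1 m2 o2 x i); lia.
  - rewrite length_map, length_seq in HP, HT. exists P. split; [trivial|].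
    intros i Hi. specialize (HT i Hi).
    (* The default is changed from 0 to [f 0], the form in which [map_nth] applies. *)
    rewrite nth_indep with (d' := f 0) in HT by (rewrite length_map, length_seq; lia).
    rewrite map_nth, seq_nth in HT by lia. unfold turn, f, side in HT. simpl in HT.
    destruct (Nat.even i); lia.
Qed.

(** * Building an embedding from vertices and cycles *)

Lemma embeds_swap S m1 o1 m2 o2 p : embeds S m1 o1 m2 o2 p -> embeds S m2 o2 m1 o1 p.
Proof. unfold embeds. tauto. Qed.

Lemma page_embeds_scale S m o p q :
  (forall x, S x -> q x = 3 * p x)%Z -> page_embeds S m o p -> page_embeds S m o q.
Proof.
  intros Hq [HM HX]. split.
  - intros x Hx Hmx Hne Ho. rewrite !Hq by trivial. specialize (HM x). intuition lia.
  - intros x y Hx Hmx Hy Hmy N1 N2 N3 N4. rewrite !Hq by trivial.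
    specialize (HX x y Hx Hmx Hy Hmy N1 N2 N3 N4). unfold crossZ in *. lia.
Qed.

Lemma crossZ_sym a b c d : crossZ a b c d -> crossZ c d a b.
Proof. unfold crossZ. tauto. Qed.

Lemma crossZ_swap a b c d : crossZ a b c d -> crossZ b a c d.
Proof. unfold crossZ. now rewrite (Z.min_comm a b), (Z.max_comm a b). Qed.

Lemma crossZ_adjacent a d c e :
  (d = 1 \/ d = -1)%Z -> ~ crossZ (a + d) a c e.
Proof. unfold crossZ. lia. Qed.

(* A vertex with at most one neighbour is placed right beside that neighbour. *)
Lemma embeds_insert S m1 o1 m2 o2 p v :
  involutive m1 -> involutive m2 ->
  (forall y, m2 y <> y -> o2 (m2 y) = negb (o2 y)) ->
  (S v -> m1 v = v \/ ~ S (m1 v)) ->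
  embeds (fun x => S x /\ x <> v) m1 o1 m2 o2 p ->
  exists q, embeds S m1 o1 m2 o2 q.
Proof.
  intros I1 I2 O2 Hv (Hinj & HE1 & HE2).
  (* A tail goes just to the left of its mate, a head just to the right. All other positions become
     multiples of 3, so the new one is free even if [m2 v] is [v] or lies outside [S], and no vertex
     comes between [v] and [m2 v]. *)
  set (d := if o2 v then (-1)%Z else 1%Z).
  assert (Hd : (d = 1 \/ d = -1)%Z) by (unfold d; destruct (o2 v); auto).
  set (q := fun x => if x =? v then (3 * p (m2 v) + d)%Z else (3 * p x)%Z).
  assert (qv : q v = (3 * p (m2 v) + d)%Z) by (unfold q; now rewrite Nat.eqb_refl).
  assert (qn : forall x, x <> v -> q x = (3 * p x)%Z).
  { intros x Hx. unfold q. destruct (Nat.eqb_spec x v); [contradiction|reflexivity]. }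
  assert (E1 : page_embeds (fun x => S x /\ x <> v) m1 o1 q)
    by (apply page_embeds_scale with p; trivial; intros x [_ Hx]; auto).
  assert (E2 : page_embeds (fun x => S x /\ x <> v) m2 o2 q)
    by (apply page_embeds_scale with p; trivial; intros x [_ Hx]; auto).
  assert (A1 : forall x, S x -> S (m1 x) -> m1 x <> x -> x <> v /\ m1 x <> v).
  { intros x H1 H2 H3. split; intros E.
    - subst x. destruct (Hv H1); auto.
    - assert (Ex : x = m1 v) by now rewrite <- E, I1.
      rewrite E in H2. destruct (Hv H2) as [H|H]; rewrite <- Ex in H; congruence. }
  exists q. split; [|split].
  - intros x y Hx Hy. destruct (Nat.eq_dec x v) as [->|Nx], (Nat.eq_dec y v) as [->|Ny];
      trivial; rewrite ?qv, ?qn by trivial; try lia.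
    intros H. apply Hinj; auto. lia.
  - destruct E1 as [HM HX]. split.
    + intros x H1 H2 H3 Ho. apply HM; trivial; split; trivial; now apply A1.
    + intros x y H1 H2 H3 H4 N1 N2 N3 N4.
      apply HX; trivial; split; trivial; now apply A1.
  - destruct E2 as [HM HX]. split.
    + intros x H1 H2 H3 Ho.
      destruct (Nat.eq_dec x v) as [->|Nx].
      { rewrite qv, qn by trivial. unfold d. rewrite Ho. lia. }
      destruct (Nat.eq_dec (m2 x) v) as [E|Nm].
      { assert (Ex : m2 v = x) by now rewrite <- E, I2.
        rewrite E, qv, qn, Ex by trivial.
        assert (Hov : o2 v = false) by (rewrite <- E, O2, Ho; trivial).
        unfold d. rewrite Hov. lia. }
      apply HM; auto.
    + assert (key : forall y, S y -> S (m2 y) -> y <> v -> m2 y <> v -> m2 v <> v ->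
        ~ crossZ (q v) (q (m2 v)) (q y) (q (m2 y))).
      { intros y H1 H2 N1 N2 N3. rewrite qv, !qn by trivial.
        now apply crossZ_adjacent. }
      assert (key' : forall x y, S x -> S (m2 x) -> S y -> S (m2 y) ->
        m2 x <> x -> m2 y <> y -> y <> x -> y <> m2 x -> (x = v \/ m2 x = v) ->
        ~ crossZ (q x) (q (m2 x)) (q y) (q (m2 y))).
      { intros x y H1 H2 H3 H4 N1 N2 N3 N4 [->|E].
        - apply key; auto. intros E. apply N4. now rewrite <- E, I2.
        - assert (Ex : x = m2 v) by now rewrite <- E, I2.
          intros C. apply crossZ_swap in C. rewrite E, Ex in C. revert C.
          rewrite E in N4. apply key; trivial.
          + intros E'. apply N3. now rewrite Ex, <- E', I2.
          + now rewrite <- Ex, <- E. }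
      intros x y H1 H2 H3 H4 N1 N2 N3 N4.
      destruct (Nat.eq_dec x v) as [Ex|Nx]; [apply key'; auto|].
      destruct (Nat.eq_dec (m2 x) v) as [Emx|Nmx]; [apply key'; auto|].
      assert (N5 : x <> m2 y) by (intros ->; apply N4; now rewrite I2).
      destruct (Nat.eq_dec y v) as [Ey|Ny];
        [intros C; apply crossZ_sym in C; revert C; apply key'; auto|].
      destruct (Nat.eq_dec (m2 y) v) as [Emy|Nmy];
        [intros C; apply crossZ_sym in C; revert C; apply key'; auto|].
      apply HX; auto.
Qed.

Lemma bounded_above (g : nat -> Z) (l : list nat) :
  exists B, forall y, In y l -> (g y < B)%Z.
Proof.
  induction l as [|a l [B HB]]; [exists 0%Z; easy|].
  exists (Z.max B (g a + 1)). intros y [->|Hy]; [lia|]. specialize (HB y Hy). lia.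
Qed.

(** Each vertex of the cycle ends one arc of either page, the one leaving it or the one entering it
    according to the parity of its index. At index 0 the entering arc is the closing one, with index
    [2 * k - 1]. *)
Lemma cycle_arc m1 m2 x k b y : involutive m1 -> involutive m2 ->
  period m1 m2 x k ->
  (exists i, i < 2 * k /\ y = curve m1 m2 x i) ->
  let m := page b m1 m2 in
  exists j, j < 2 * k /\ Nat.even j = b /\
    ((y = curve m1 m2 x j /\ m y = curve m1 m2 x (S j)) \/
     (y = curve m1 m2 x (S j) /\ m y = curve m1 m2 x j)).
Proof.
  intros I1 I2 HP (i & Hi & ->) m.
  assert (Im : involutive m) by (unfold m; now destruct b).
  assert (back : forall j, Nat.even j = b ->
    m (curve m1 m2 x (S j)) = curve m1 m2 x j).
  { intros j Hj. rewrite curve_succ, Hj. apply Im. }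
  destruct (Bool.bool_dec (Nat.even i) b) as [E|E].
  - exists i. split; [trivial|]. split; [trivial|]. left.
    rewrite curve_succ, E. auto.
  - assert (E' : Nat.even (S i) = b).
    { rewrite Nat.even_succ, <- Nat.negb_even.
      destruct (Nat.even i), b; simpl; congruence. }
    destruct i as [|i].
    + assert (H0 : Nat.even (2 * k - 1) = b).
      { replace (2 * k - 1) with (S (2 * (k - 1))) by lia.
        rewrite Nat.even_succ, <- Nat.negb_even, Nat.even_even.
        destruct b; [now elim E|reflexivity]. }
      exists (2 * k - 1). split; [lia|]. split; [trivial|]. right.
      specialize (back _ H0).
      replace (S (2 * k - 1)) with (2 * k) in * by lia.
      rewrite (curve_closed m1 m2 x k) in * by trivial. auto.
    + exists i. split; [lia|].
      rewrite Nat.even_succ_succ in E'. split; [trivial|]. right. auto.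
Qed.

(** The condition on the turns yields a meander with the prescribed edge directions. It is shifted
    to the right of all other vertices, and since no edge joins the cycle to the rest, edges of the
    two parts occupy disjoint intervals. *)
Lemma embeds_add_cycle (l : list nat) m1 o1 m2 o2 x k p :
  involutive m1 -> involutive m2 ->
  (forall y, m1 y <> y -> o1 (m1 y) = negb (o1 y)) ->
  (forall y, m2 y <> y -> o2 (m2 y) = negb (o2 y)) ->
  period m1 m2 x k -> unmatched_free m1 m2 x k -> good m1 o1 m2 o2 x ->
  embeds (fun y => In y l /\ forall i, i < 2 * k -> y <> curve m1 m2 x i)
    m1 o1 m2 o2 p ->
  exists q, embeds (fun y => In y l) m1 o1 m2 o2 q.
Proof.
  intros I1 I2 O1 O2 HP HF HG (Hinj & HE1 & HE2).
  set (c := curve m1 m2 x) in *. set (N := 2 * k) in *.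
  assert (Hk : 0 < k) by apply HP.
  destruct (cycle_positions m1 o1 m2 o2 x k Hk (HG k HP HF)) as (P & HM & HT).
  fold N in HM, HT.
  assert (Hd := curve_distinct m1 m2 x k I1 I2 HP HF). fold c N in Hd.
  assert (HcN : c N = c 0) by now apply curve_closed.
  (* [B] exceeds all old positions and [B'] all values [- P i], so [P i + B + B'] lies above [B]. *)
  destruct (bounded_above p l) as [B HB].
  destruct (bounded_above (fun i => (- P i)%Z) (seq 0 (S N))) as [B' HB'].
  set (q := fun y => match find (fun i => y =? c i) (seq 0 N) with
                     | Some i => (P i + B + B')%Z | None => p y end).
  set (inC := fun y => exists i, i < N /\ y = c i).
  assert (qC : forall i, i <= N -> q (c i) = (P i + B + B')%Z).
  { assert (lt : forall i, i < N -> q (c i) = (P i + B + B')%Z).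
    { intros i Hi. unfold q. destruct (find _ _) as [j|] eqn:F.
      - apply find_some in F as [Hj E]. apply in_seq in Hj. apply Nat.eqb_eq in E.
        destruct (Nat.lt_total i j) as [L|[->|L]]; [|trivial|].
        + destruct (Hd i j); [lia|trivial].
        + destruct (Hd j i); [lia|auto].
      - apply find_none with (x := i) in F; [|apply in_seq; lia].
        rewrite Nat.eqb_refl in F. discriminate. }
    intros i Hi. destruct (Nat.eq_dec i N) as [->|]; [|apply lt; lia].
    rewrite HcN, (cm_closed _ _ HM). apply lt. lia. }
  assert (qR : forall y, ~ inC y -> q y = p y).
  { intros y Hy. unfold q. destruct (find _ _) as [j|] eqn:F; [|trivial].
    apply find_some in F as [Hj E]. apply in_seq in Hj. apply Nat.eqb_eq in E.
    destruct Hy. exists j. split; [lia|trivial]. }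
  assert (decC : forall y, inC y \/ ~ inC y).
  { intros y. destruct (find (fun i => y =? c i) (seq 0 N)) as [j|] eqn:F.
    - apply find_some in F as [Hj E]. apply in_seq in Hj. apply Nat.eqb_eq in E.
      left. exists j. split; [lia|trivial].
    - right. intros (i & Hi & E). apply find_none with (x := i) in F;
        [|apply in_seq; lia]. apply Nat.eqb_neq in F. auto. }
  assert (high : forall i, i <= N -> (B < q (c i))%Z).
  { intros i Hi. rewrite qC by trivial. specialize (HB' i).
    assert (- P i < B')%Z by (apply HB', in_seq; lia). lia. }
  assert (low : forall y, In y l -> ~ inC y -> (q y < B)%Z).
  { intros y Hy Hn. rewrite qR by trivial. now apply HB. }
  assert (rest : forall y, In y l -> ~ inC y ->
    In y l /\ forall i, i < N -> y <> c i).
  { intros y Hy Hn. split; [trivial|]. intros i Hi E. apply Hn. now exists i. }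
  exists q. split.
  - intros y z Hy Hz E. destruct (decC y) as [(i & Hi & Ei)|Cy],
      (decC z) as [(j & Hj & Ej)|Cz].
    + subst y z. rewrite !qC in E by lia.
      destruct (Nat.lt_total i j) as [L|[->|L]]; [|trivial|].
      * destruct (cm_inj _ _ HM i j); lia.
      * destruct (cm_inj _ _ HM j i); lia.
    + subst y. assert (H1 := high i ltac:(lia)). assert (H2 := low z Hz Cz). lia.
    + subst z. assert (H1 := high j ltac:(lia)). assert (H2 := low y Hy Cy). lia.
    + rewrite !qR in E by trivial. apply Hinj; auto.
  - assert (pages : forall b, let m := page b m1 m2 in let o := page b o1 o2 in
      involutive m -> (forall y, m y <> y -> o (m y) = negb (o y)) ->
      page_embeds (fun y => In y l /\ forall i, i < N -> y <> c i) m o p ->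
      page_embeds (fun y => In y l) m o q).
    { intros b m o Im Om [HMo HX].
      assert (arc : forall y, inC y -> exists j, j < N /\ Nat.even j = b /\
        ((y = c j /\ m y = c (S j)) \/ (y = c (S j) /\ m y = c j))).
      { intros y Hy. apply (cycle_arc m1 m2 x k b y I1 I2 HP Hy). }
      assert (clC : forall y, inC y -> inC (m y)).
      { assert (le : forall i, i <= N -> inC (c i)).
        { intros i Hi. destruct (Nat.eq_dec i N) as [->|].
          - exists 0. split; [lia|trivial].
          - exists i. split; [lia|trivial]. }
        intros y Hy. destruct (arc y Hy) as (j & Hj & _ & [[_ ->]|[_ ->]]);
          apply le; lia. }
      assert (clR : forall y, ~ inC y -> ~ inC (m y)).
      { intros y Hy H. apply Hy. rewrite <- (Im y). auto. }
      split.
      - intros y Hy Hmy Hne Ho. destruct (decC y) as [Cy|Cy].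
        + destruct (arc y Cy) as (j & Hj & Ej & D).
          specialize (HT j Hj). unfold curve_out in HT. fold c in HT.
          rewrite Ej in HT. fold o in HT.
          destruct D as [[E1 E2]|[E1 E2]]; rewrite E2; rewrite E1 at 1;
            rewrite !qC by lia.
          * rewrite <- E1, Ho in HT. simpl in HT. apply Z.sgn_pos_iff in HT. lia.
          * rewrite <- E2, Om, Ho in HT by trivial. simpl in HT.
            apply Z.sgn_neg_iff in HT. lia.
        + rewrite !qR by auto. apply HMo; auto.
      - intros y z Hy Hmy Hz Hmz N1 N2 N3 N4.
        destruct (decC y) as [Cy|Cy], (decC z) as [Cz|Cz].
        + assert (key : forall i j y z, i < j -> j < N -> Nat.even i = b ->
            Nat.even j = b ->
            ((y = c i /\ m y = c (S i)) \/ (y = c (S i) /\ m y = c i)) ->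
            ((z = c j /\ m z = c (S j)) \/ (z = c (S j) /\ m z = c j)) ->
            ~ crossZ (q y) (q (m y)) (q z) (q (m z))).
          { clear y z Hy Hmy Hz Hmz N1 N2 N3 N4 Cy Cz.
            intros i j y z Hij Hj Ei Ej Dy Dz.
            assert (X := cm_nocross _ _ HM i j ltac:(lia) ltac:(congruence)).
            intros C. apply X. clear X.
            destruct Dy as [[E1 E2]|[E1 E2]], Dz as [[E3 E4]|[E3 E4]];
              rewrite E2, E4 in C; rewrite E1, E3, !qC in C by lia;
              unfold crossZ in *; lia. }
          destruct (arc y Cy) as (i & Hi & Ei & Dy).
          destruct (arc z Cz) as (j & Hj & Ej & Dz).
          destruct (Nat.lt_total i j) as [L|[->|L]].
          * now apply (key i j).
          * destruct Dy as [[E1 E2]|[E1 E2]], Dz as [[E3 E4]|[E3 E4]]; congruence.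
          * intros C. apply crossZ_sym in C. revert C. now apply (key j i).
        + assert (L1 := low z Hz Cz). assert (L2 := low (m z) Hmz (clR z Cz)).
          destruct (arc y Cy) as (i & Hi & _ & D).
          assert (G1 := high i ltac:(lia)). assert (G2 := high (S i) ltac:(lia)).
          destruct D as [[E1 E2]|[E1 E2]]; rewrite E2; rewrite E1;
            unfold crossZ; lia.
        + assert (L1 := low y Hy Cy). assert (L2 := low (m y) Hmy (clR y Cy)).
          destruct (arc z Cz) as (i & Hi & _ & D).
          assert (G1 := high i ltac:(lia)). assert (G2 := high (S i) ltac:(lia)).
          destruct D as [[E1 E2]|[E1 E2]]; rewrite E2; rewrite E1;
            unfold crossZ; lia.
        + rewrite !qR by auto. apply HX; auto. }
    split; [apply (pages true)|apply (pages false)]; trivial.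
Qed.

Lemma page_embeds_weaken (S T : nat -> Prop) m o p :
  (forall x, S x -> T x) -> page_embeds T m o p -> page_embeds S m o p.
Proof.
  intros H [HM HX]. split; [intros x ? ?; apply HM|intros x y ? ? ? ?; apply HX]; auto.
Qed.

Lemma embeds_weaken (S T : nat -> Prop) m1 o1 m2 o2 p :
  (forall x, S x -> T x) -> embeds T m1 o1 m2 o2 p -> embeds S m1 o1 m2 o2 p.
Proof.
  intros H (A & B & C). split; [auto|].
  split; eapply page_embeds_weaken; eauto.
Qed.

Lemma embeds_of_good m1 o1 m2 o2 : involutive m1 -> involutive m2 ->
  (forall y, m1 y <> y -> o1 (m1 y) = negb (o1 y)) ->
  (forall y, m2 y <> y -> o2 (m2 y) = negb (o2 y)) ->
  (forall x, good m1 o1 m2 o2 x) ->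
  forall l, exists p, embeds (fun x => In x l) m1 o1 m2 o2 p.
Proof.
  intros I1 I2 O1 O2 HG l. remember (length l) as n eqn:En.
  revert l En. induction n as [n IH] using lt_wf_ind. intros l ->.
  (* Being lone is relative to the vertices still in [l], so that paths are taken apart from their
     ends. *)
  set (lone := fun m v => m v = v \/ ~ In (m v) l).
  assert (dec : forall m v, {lone m v} + {~ lone m v}).
  { intros m v. unfold lone. destruct (Nat.eq_dec (m v) v); [left; auto|].
    destruct (in_dec Nat.eq_dec (m v) l); [right; tauto|left; auto]. }
  assert (rm : forall v, In v l -> exists p,
    embeds (fun y => In y l /\ y <> v) m1 o1 m2 o2 p).
  { intros v Hv.
    destruct (IH (length (remove Nat.eq_dec v l))) with (l := remove Nat.eq_dec v l)
      as [p Hp]; trivial; [now apply remove_length_lt|].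
    exists p. revert Hp. apply embeds_weaken. intros y [Hy Hn].
    now apply in_in_remove. }
  destruct (Exists_dec (lone m1) l (dec m1)) as [D|D1].
  { apply Exists_exists in D as (v & Hv & Lv). destruct (rm v Hv) as [p Hp].
    now apply embeds_insert with (v := v) (p := p). }
  destruct (Exists_dec (lone m2) l (dec m2)) as [D|D2].
  { apply Exists_exists in D as (v & Hv & Lv). destruct (rm v Hv) as [p Hp].
    destruct (embeds_insert (fun y => In y l) m2 o2 m1 o1 p v) as [q Hq]; trivial.
    - now apply embeds_swap.
    - exists q. now apply embeds_swap. }
  (* No vertex of [l] is lone any more: both involutions map [l] into itself without fixed points
     there, so the orbit of any vertex of [l] lies on a cycle inside [l]. *)
  assert (matched : forall m, ~ Exists (lone m) l -> forall v, In v l ->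
    m v <> v /\ In (m v) l).
  { intros m D v Hv. destruct (dec m v) as [L|L].
    - destruct D. apply Exists_exists. now exists v.
    - unfold lone in L. destruct (in_dec Nat.eq_dec (m v) l); tauto. }
  assert (M1 := matched m1 D1). assert (M2 := matched m2 D2).
  destruct l as [|x l'].
  { exists Z.of_nat. split; [|split; split]; easy. }
  set (l := x :: l') in *.
  assert (Hx : In x l) by now left.
  assert (Hn : forall y, In y l -> In (nxt m1 m2 y) l).
  { intros y Hy. apply M2, M1, Hy. }
  destruct (period_exists m1 m2 l x I1 I2 Hn Hx) as [k HP].
  assert (HF : unmatched_free m1 m2 x k).
  { assert (HO : forall i, In (Nat.iter i (nxt m1 m2) x) l)
      by (induction i as [|i IHi]; [exact Hx|apply Hn, IHi]).
    intros i _ y. split; [apply M1, HO|apply M2, M1, HO]. }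
  set (inb := fun y => existsb (fun i => y =? curve m1 m2 x i) (seq 0 (2 * k))).
  destruct (IH (length (filter (fun y => negb (inb y)) l)))
    with (l := filter (fun y => negb (inb y)) l) as [p Hp]; trivial.
  { assert (L := filter_length_lt (fun y => negb (inb y)) (fun _ => true) l x).
    eapply Nat.lt_le_trans; [apply L|apply filter_length_le]; trivial.
    apply negb_false_iff, existsb_exists. exists 0. split.
    - apply in_seq. destruct HP. lia.
    - apply Nat.eqb_refl. }
  apply embeds_add_cycle with (x := x) (k := k) (p := p); trivial.
  revert Hp. apply embeds_weaken. intros y [Hy Hc]. apply filter_In. split; [trivial|].
  apply negb_true_iff, not_true_iff_false. intros H.
  apply existsb_exists in H as (i & Hi & E). apply in_seq in Hi.
  apply Nat.eqb_eq in E. apply (Hc i); [lia|trivial].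
Qed.

(** Moving the start along the orbit shifts the sum cyclically. One test per orbit therefore decides
    for all its vertices. *)
Lemma good_nxt m1 o1 m2 o2 x : involutive m1 -> involutive m2 ->
  good m1 o1 m2 o2 x -> good m1 o1 m2 o2 (nxt m1 m2 x).
Proof.
  intros I1 I2 HG k HP HF.
  set (f := nxt m1 m2) in *.
  assert (sh : forall i, Nat.iter i f (f x) = f (Nat.iter i f x)).
  { intros i. exact (eq_sym (Nat.iter_succ_r i _ f x)). }
  assert (HPx : period m1 m2 x k).
  { destruct HP as (Hk & E & Hmin). split; [trivial|]. split.
    - apply (nxt_inj m1 m2 I1 I2). change (f (Nat.iter k f x) = f x).
      rewrite <- sh. exact E.
    - intros i Hi Ei. apply (Hmin i Hi). fold f. rewrite sh. now f_equal. }
  assert (Ek : Nat.iter k f x = x) by apply HPx.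
  assert (HFx : unmatched_free m1 m2 x k).
  { intros [|i] Hi; fold f.
    - specialize (HF (k - 1) ltac:(lia)). fold f in HF. rewrite sh in HF.
      change (f (Nat.iter (k - 1) f x)) with (Nat.iter (S (k - 1)) f x) in HF.
      replace (S (k - 1)) with k in HF by lia. now rewrite Ek in HF.
    - specialize (HF i ltac:(lia)). fold f in HF. now rewrite sh in HF. }
  rewrite <- (HG k HPx HFx). f_equal. fold f.
  set (g := fun i => weight m1 o1 o2 (Nat.iter i f x)).
  rewrite (zsum_ext _ (fun i => g (S i))) by (intros i _; unfold g; now rewrite sh).
  assert (E := zsum_S g k). assert (gk : g k = g 0) by (unfold g; now rewrite Ek).
  simpl zsum in E. lia.
Qed.

(** * The algorithm *)

(* Memory layout for [M = 64 * n], all offsets being multiples of [M]: the edge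
   list at [M], the two mate tables at [2M] and [3M], the clockwise marks of the
   half turns at [4M] and [5M], the visited marks at [6M]. The factor [64] makes
   room for the 16 registers even when [n = 1]. *)
Definition regs (M a b r9 r10 r11 r12 r13 r14 r15 : nat) : list nat :=
  [M; a; b; 2 * M; 3 * M; 4 * M; 5 * M; 6 * M; 1; r9; r10; r11; r12; r13; r14; r15].

Definition double_n : com := CBlock (repeat (IAdd 0 0 0) 6).

(** The input has its edges from cell 3 on, where the registers are to be. The 13 cells 3 to 15 are
    saved one by one, register 3 serving as address register once its own content is stored. The
    rest sets up the registers; 9, 10 and 11 become source, count and target for copying the cells
    from 16 on. *)
Definition relocate : com := CBlock
  (IStore 0 3 ::
   flat_map (fun i => [IConst 3 i; IAdd 3 3 0; IStore 3 (3 + i)]) (seq 1 12) ++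
   [IConst 8 1; IAdd 3 0 0; IAdd 4 3 0; IAdd 5 4 0; IAdd 6 5 0; IAdd 7 6 0;
    IConst 9 16; ISub 10 0 9; IConst 11 13; IAdd 11 11 0]).

Definition copy_edges : com := CWhile 10 (CBlock
  [ILoad 12 9; IStore 11 12; IAdd 9 9 8; IAdd 11 11 8; ISub 10 10 8]).

Definition init_mates : com := CSeq (CBlock [IConst 9 0; IAdd 10 0 9])
  (CWhile 10 (CBlock
    [ISub 10 10 8; IAdd 11 3 10; IStore 11 10; IAdd 11 4 10; IStore 11 10])).

Definition load_E1 : com := CSeq (CBlock [IConst 9 0; IAdd 9 0 9])
  (CWhile 1 (CBlock
    [ILoad 11 9; IAdd 9 9 8; ILoad 12 9; IAdd 9 9 8;
     IAdd 13 3 12; IStore 13 11; IAdd 13 3 11; IStore 13 12;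
     IAdd 13 5 11; IStore 13 8; ISub 1 1 8])).

Definition load_E2 : com := CWhile 2 (CBlock
    [ILoad 11 9; IAdd 9 9 8; ILoad 12 9; IAdd 9 9 8;
     IAdd 13 4 12; IStore 13 11; IAdd 13 4 11; IStore 13 12;
     IAdd 13 6 12; IStore 13 8; ISub 2 2 8]).

(* Register 10 holds the start and 11 the current vertex; 12 counts clockwise
   half turns, 13 all half turns, 14 unmatched ends. *)
Definition walk : com := CWhile 9 (CBlock
  [IAdd 15 7 11; IStore 15 8;
   IAdd 15 5 11; ILoad 15 15; IAdd 12 12 15;
   IAdd 15 3 11; ILoad 9 15;
   ISub 2 9 11; ISub 11 11 9; IAdd 2 2 11; ISub 2 8 2; IAdd 14 14 2; ILoad 11 15;
   IAdd 15 6 11; ILoad 15 15; IAdd 12 12 15;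
   IAdd 15 4 11; ILoad 9 15;
   ISub 2 9 11; ISub 11 11 9; IAdd 2 2 11; ISub 2 8 2; IAdd 14 14 2; ILoad 11 15;
   IAdd 13 13 8; IAdd 13 13 8;
   ISub 9 11 10; ISub 2 10 11; IAdd 9 9 2]).

(** With [A] clockwise ones among [N] half turns the sum is [2 * A - N]. Its absolute value, and
    then the distance of that from 2, are computed by truncated subtractions; the last instruction
    clears the answer in register 1 unless this distance is 0. *)
Definition verdict : com := CIfz 14
  (CBlock [IAdd 12 12 12; ISub 9 12 13; ISub 2 13 12; IAdd 9 9 2;
           IConst 2 2; ISub 11 9 2; ISub 2 2 9; IAdd 2 2 11; ISub 1 1 2])
  (CBlock []).

(** All [M] table indices are tried as starts; those from [n] on are isolated vertices. Register 9
    is set to 1 to force the first round of [walk], since the current vertex still equals the start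
    there. *)
Definition search : com := CSeq (CBlock [IConst 1 1; IConst 9 0; IAdd 10 0 9])
  (CWhile 10
    (CSeq (CBlock [ISub 10 10 8; IAdd 11 7 10; ILoad 12 11])
      (CIfz 12
        (CSeq (CBlock [IConst 12 0; IConst 13 0; IConst 14 0; IAdd 11 10 12; IConst 9 1])
          (CSeq walk verdict))
        (CBlock [])))).

(** For [n = 0] all tables would begin at cell 0, inside the registers; the answer is positive in
    that case. *)
Definition decide : com :=
  CIfz 0 (CBlock [IConst 0 1])
    (CSeq double_n (CSeq relocate (CSeq copy_edges (CSeq init_mates
      (CSeq load_E1 (CSeq load_E2 (CSeq search (CBlock [IConst 9 0; IAdd 0 1 9])))))))).

(** * Correctness of the set-up phases *)

Lemma upd_same h a x : upd h a x a = x.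
Proof. unfold upd. now rewrite Nat.eqb_refl. Qed.

Lemma upd_other h a x b : b <> a -> upd h a x b = h b.
Proof. intros H. unfold upd. destruct (Nat.eqb_spec b a); [contradiction|reflexivity]. Qed.

Ltac run_block :=
  cbv delta [regs] beta; eapply wp_block; [simpl length; reflexivity|];
  cbv beta iota delta [wp_instrs set_nth nth];
  repeat match goal with
  | |- _ < 16 /\ _ => split; [lia|]
  | |- 16 <= _ /\ _ => split; [lia|]
  end.

Ltac regs_eq :=
  unfold regs;
  repeat (apply (f_equal2 (@cons nat)); [first [reflexivity | lia]|]);
  reflexivity.

Definition tab (h : memory) (M b : nat) (f : nat -> nat) : Prop :=
  forall v, v < M -> h (b * M + v) = f v.

Lemma tab_upd_other h M b f a x : a < b * M \/ S b * M <= a ->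
  tab h M b f -> tab (upd h a x) M b f.
Proof. intros Ha H v Hv. rewrite upd_other by (simpl in *; lia). now apply H. Qed.

Lemma tab_upd h M b f w x : tab h M b f ->
  tab (upd h (b * M + w) x) M b (fun v => if v =? w then x else f v).
Proof.
  intros H v Hv. destruct (Nat.eqb_spec v w) as [->|N]; [apply upd_same|].
  rewrite upd_other by lia. now apply H.
Qed.

Lemma tab_ext h M b f g : (forall v, v < M -> f v = g v) -> tab h M b f -> tab h M b g.
Proof. intros E H v Hv. rewrite <- E by trivial. now apply H. Qed.

Lemma wp_double enc :
  wp double_n (map enc (seq 0 16)) enc (fun t rs h =>
    t = 6 /\ h = enc /\ rs = (64 * enc 0) :: map enc (seq 1 15)).
Proof.
  unfold double_n. cbn [map seq repeat]. run_block.
  split; [reflexivity|]. split; [reflexivity|]. f_equal. lia.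
Qed.

Lemma wp_relocate M enc : 64 <= M ->
  wp relocate (M :: map enc (seq 1 15)) enc (fun t rs h =>
    t = 47 /\ (exists r12 r13 r14 r15,
      rs = regs M (enc 1) (enc 2) 16 (M - 16) (M + 13) r12 r13 r14 r15) /\
    (forall k, k < 13 -> h (M + k) = enc (3 + k)) /\
    (forall a, 16 <= a -> a < M \/ M + 13 <= a -> h a = enc a)).
Proof.
  intros HM. unfold relocate. cbn [map seq flat_map app Nat.add]. run_block.
  split; [reflexivity|]. split; [|split].
  - do 4 eexists. regs_eq.
  - intros k Hk. do 13 (destruct k as [|k];
      [repeat (rewrite upd_other by lia);
       match goal with |- upd _ ?a _ ?b = _ => replace b with a by lia end;
       apply upd_same|]). lia.
  - intros a Ha Ha'. repeat (rewrite upd_other by lia). reflexivity.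
Qed.

(** The length [M - 3] counts the first [M] input cells without the 3 header cells. As the encoded
    input ends before [M], the cells from [2 * M] on are still 0 afterwards, and the mark tables
    start out from these zeros. *)
Lemma wp_copy M a b r12 r13 r14 r15 enc h : 64 <= M ->
  (forall k, k < 13 -> h (M + k) = enc (3 + k)) ->
  (forall a, 16 <= a -> a < M \/ M + 13 <= a -> h a = enc a) ->
  (forall a, M <= a -> enc a = 0) ->
  wp copy_edges (regs M a b 16 (M - 16) (M + 13) r12 r13 r14 r15) h (fun t rs h' =>
    t <= 8 * M /\ (exists r9 r10 r11 r12 r13 r14 r15,
      rs = regs M a b r9 r10 r11 r12 r13 r14 r15) /\
    (forall k, k < M - 3 -> h' (M + k) = enc (3 + k)) /\
    (forall a, 2 * M <= a -> h' a = 0)).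
Proof.
  intros HM Hlow Hrest Henc. unfold copy_edges.
  eapply wp_mono.
  - apply (wp_while _ _
      (fun rs h => exists i r12, 16 <= i <= M /\
         rs = regs M a b i (M - i) (M + (i - 3)) r12 r13 r14 r15 /\
         (forall k, k < i - 3 -> h (M + k) = enc (3 + k)) /\
         (forall a, 16 <= a -> a < M \/ M + (i - 3) <= a -> h a = enc a))
      (fun rs _ => 7 * nth 10 rs 0)); [lia| |].
    + clear dependent h. clear r12. intros rs h (i & r12 & Hi & -> & Hlow & Hrest) Hne.
      cbn [nth regs] in Hne. run_block. split; [|lia].
      exists (i + 1). eexists. split; [lia|]. split; [|split].
      * regs_eq.
      * intros k Hk. destruct (Nat.eq_dec k (i - 3)) as [->|].
        -- rewrite upd_same, Hrest by lia. f_equal. lia.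
        -- rewrite upd_other by lia. apply Hlow. lia.
      * intros c Hc Hc'. rewrite upd_other by lia. apply Hrest; lia.
    + exists 16, r12. split; [lia|]. split; [reflexivity|]. auto.
  - intros t rs h' ((i & s12 & Hi & -> & Hlow' & Hrest') & Hz & Ht).
    cbn [nth regs] in Hz, Ht. replace i with M in * by lia.
    split; [lia|]. split; [do 7 eexists; reflexivity|]. split; [trivial|].
    intros c Hc. rewrite Hrest' by lia. apply Henc. lia.
Qed.

Lemma wp_init M a b r9 r10 r11 r12 r13 r14 r15 enc h : 64 <= M ->
  (forall k, k < M - 3 -> h (M + k) = enc (3 + k)) ->
  (forall a, 2 * M <= a -> h a = 0) ->
  wp init_mates (regs M a b r9 r10 r11 r12 r13 r14 r15) h (fun t rs h' =>
    t <= 8 * M /\ (exists r9 r10 r11 r12 r13 r14 r15,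
      rs = regs M a b r9 r10 r11 r12 r13 r14 r15) /\
    (forall k, k < M - 3 -> h' (M + k) = enc (3 + k)) /\
    tab h' M 2 (fun v => v) /\ tab h' M 3 (fun v => v) /\
    (forall a, 4 * M <= a -> h' a = 0)).
Proof.
  intros HM Hed Hz. unfold init_mates. apply wp_seq. run_block.
  eapply wp_mono.
  - apply (wp_while _ _
      (fun rs h => exists v r11, v <= M /\
         rs = regs M a b 0 v r11 r12 r13 r14 r15 /\
         (forall k, k < M - 3 -> h (M + k) = enc (3 + k)) /\
         (forall x, v <= x < M -> h (2 * M + x) = x /\ h (3 * M + x) = x) /\
         (forall a, 4 * M <= a -> h a = 0))
      (fun rs _ => 7 * nth 10 rs 0)); [lia| |].
    + clear dependent h. clear r11. intros rs h (v & r11 & Hv & -> & Hed & Htab & Hz) Hne.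
      cbn [nth regs] in Hne. run_block. split; [|lia].
      exists (v - 1). eexists. split; [lia|]. split; [reflexivity|]. split; [|split].
      * intros k Hk. rewrite !upd_other by lia. auto.
      * intros x Hx. destruct (Nat.eq_dec x (v - 1)) as [->|].
        -- rewrite upd_same, upd_other, upd_same by lia. auto.
        -- rewrite !upd_other by lia. apply Htab. lia.
      * intros c Hc. rewrite !upd_other by lia. auto.
    + exists M, r11. split; [lia|]. split; [regs_eq|].
      split; [trivial|]. split; [lia|]. intros c Hc. apply Hz. lia.
  - intros t rs h' ((v & s11 & Hv & -> & Hed' & Htab & Hz') & H0 & Ht).
    cbn [nth regs] in H0, Ht. subst v.
    split; [lia|]. split; [do 7 eexists; reflexivity|]. split; [trivial|].
    split; [|split; [|trivial]]; intros x Hx; apply Htab; lia.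
Qed.

Lemma nth_flat_edges (d : list edge) u v (t : list edge) :
  nth (2 * length d) (flat_edges (d ++ (u, v) :: t)) 0 = u /\
  nth (S (2 * length d)) (flat_edges (d ++ (u, v) :: t)) 0 = v.
Proof.
  induction d as [|e d IH]; [split; reflexivity|].
  replace (2 * length (e :: d)) with (S (S (2 * length d))) by (simpl; lia).
  destruct e. exact IH.
Qed.

Lemma length_flat_edges E : length (flat_edges E) = 2 * length E.
Proof. induction E as [|[u v] E IH]; simpl; lia. Qed.

Definition turn_bit (b : bool) : nat := if b then 1 else 0.

Lemma wp_load_E1 M b r9 r10 r11 r12 r13 r14 r15 E1 E2 h : 64 <= M ->
  2 * length (E1 ++ E2) <= M - 3 -> edges_in_range M (E1 ++ E2) ->
  (forall k, k < M - 3 -> h (M + k) = nth k (flat_edges (E1 ++ E2)) 0) ->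
  tab h M 2 (fun v => v) -> tab h M 3 (fun v => v) ->
  (forall a, 4 * M <= a -> h a = 0) ->
  wp load_E1 (regs M (length E1) b r9 r10 r11 r12 r13 r14 r15) h (fun t rs h' =>
    t <= 13 * M /\ (exists r10 r11 r12 r13 r14 r15,
      rs = regs M 0 b (M + 2 * length E1) r10 r11 r12 r13 r14 r15) /\
    (forall k, k < M - 3 -> h' (M + k) = nth k (flat_edges (E1 ++ E2)) 0) /\
    tab h' M 2 (mate (rev E1)) /\ tab h' M 3 (fun v => v) /\
    tab h' M 4 (fun v => turn_bit (is_tail (rev E1) v)) /\
    (forall a, 5 * M <= a -> h' a = 0)).
Proof.
  intros HM Hlen HR Hed H2 H3 Hz. unfold load_E1. apply wp_seq. run_block.
  eapply wp_mono.
  - apply (wp_while _ _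
      (fun rs h => exists dn td r11 r12 r13, E1 = dn ++ td /\
         rs = regs M (length td) b (M + 2 * length dn) r10 r11 r12 r13 r14 r15 /\
         (forall k, k < M - 3 -> h (M + k) = nth k (flat_edges (E1 ++ E2)) 0) /\
         tab h M 2 (mate (rev dn)) /\ tab h M 3 (fun v => v) /\
         tab h M 4 (fun v => turn_bit (is_tail (rev dn) v)) /\
         (forall a, 5 * M <= a -> h a = 0))
      (fun rs _ => 13 * nth 1 rs 0)); [lia| |].
    + clear dependent h. clear r11 r12 r13.
      intros rs h (dn & td & r11 & r12 & r13 & EE & -> & Hed & H2 & H3 & H4 & Hz) Hne.
      cbn [nth regs] in Hne. destruct td as [|[u v] td]; [simpl in Hne; lia|].
      assert (Hdn : 2 * length dn + 2 <= M - 3)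
        by (rewrite EE, !length_app in Hlen; simpl in Hlen; lia).
      assert (Huv : u < M /\ v < M).
      { apply HR. rewrite EE, <- app_assoc. apply in_or_app. right. now left. }
      destruct (nth_flat_edges dn u v (td ++ E2)) as [Nu Nv].
      assert (EE' : dn ++ (u, v) :: td ++ E2 = E1 ++ E2)
        by (rewrite EE, <- app_assoc; reflexivity).
      rewrite EE', <- Hed in Nu, Nv by lia.
      assert (Nv' : h (M + 2 * length dn + 1) = v) by (rewrite <- Nv; f_equal; lia).
      run_block; try (rewrite ?Nu, ?Nv'; lia). split; [|simpl; lia].
      rewrite Nu, Nv'.
      exists (dn ++ [(u, v)]), td. do 3 eexists.
      split; [now rewrite <- app_assoc|]. split; [|split; [|split; [|split; [|split]]]].
      * rewrite length_app. simpl length. regs_eq.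
      * intros k Hk. rewrite !upd_other by lia. auto.
      * apply tab_upd_other; [lia|]. rewrite rev_app_distr. simpl rev.
        eapply tab_ext; [|apply tab_upd, tab_upd, H2]. intros x _. simpl. reflexivity.
      * apply tab_upd_other; [lia|]. apply tab_upd_other; [lia|].
        apply tab_upd_other; [lia|]. exact H3.
      * rewrite rev_app_distr. simpl rev.
        eapply tab_ext; [|apply tab_upd, tab_upd_other, tab_upd_other, H4; lia].
        intros x _. simpl. now destruct (x =? u).
      * intros c Hc. rewrite !upd_other by lia. auto.
    + exists [], E1. do 3 eexists. split; [reflexivity|]. split; [|split; [|split; [|split; [|split]]]].
      * simpl length. regs_eq.
      * exact Hed.
      * exact H2.
      * exact H3.
      * intros x Hx. apply Hz. lia.
      * intros c Hc. apply Hz. lia.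
  - intros t rs h' ((dn & td & s11 & s12 & s13 & EE & -> & Hed' & H2' & H3' & H4' & Hz') & H0 & Ht).
    cbn [nth regs] in H0, Ht. destruct td; [|discriminate]. rewrite app_nil_r in EE.
    subst dn. simpl length in Ht. rewrite length_app in Hlen.
    split; [simpl length; lia|]. split; [do 6 eexists; reflexivity|]. auto.
Qed.

Lemma wp_load_E2 M r10 r11 r12 r13 r14 r15 E1 E2 h f g : 64 <= M ->
  2 * length (E1 ++ E2) <= M - 3 -> edges_in_range M (E1 ++ E2) ->
  (forall k, k < M - 3 -> h (M + k) = nth k (flat_edges (E1 ++ E2)) 0) ->
  tab h M 2 f -> tab h M 3 (fun v => v) -> tab h M 4 g ->
  (forall a, 5 * M <= a -> h a = 0) ->
  wp load_E2 (regs M 0 (length E2) (M + 2 * length E1) r10 r11 r12 r13 r14 r15) h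
   (fun t rs h' =>
    t <= 13 * M /\ (exists b r9 r10 r11 r12 r13 r14 r15,
      rs = regs M 0 b r9 r10 r11 r12 r13 r14 r15) /\
    tab h' M 2 f /\ tab h' M 3 (mate (rev E2)) /\ tab h' M 4 g /\
    tab h' M 5 (fun v => turn_bit (is_head (rev E2) v)) /\
    (forall a, 6 * M <= a -> h' a = 0)).
Proof.
  intros HM Hlen HR Hed H2 H3 H4 Hz. unfold load_E2.
  eapply wp_mono.
  - apply (wp_while _ _
      (fun rs h => exists dn td r11 r12 r13, E2 = dn ++ td /\
         rs = regs M 0 (length td) (M + 2 * length (E1 ++ dn)) r10 r11 r12 r13 r14 r15 /\
         (forall k, k < M - 3 -> h (M + k) = nth k (flat_edges (E1 ++ E2)) 0) /\
         tab h M 2 f /\ tab h M 3 (mate (rev dn)) /\ tab h M 4 g /\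
         tab h M 5 (fun v => turn_bit (is_head (rev dn) v)) /\
         (forall a, 6 * M <= a -> h a = 0))
      (fun rs _ => 13 * nth 2 rs 0)); [lia| |].
    + clear dependent h. clear r11 r12 r13.
      intros rs h (dn & td & r11 & r12 & r13 & EE & -> & Hed & H2 & H3 & H4 & H5 & Hz) Hne.
      cbn [nth regs] in Hne. destruct td as [|[u v] td]; [simpl in Hne; lia|].
      assert (Hdn : 2 * length (E1 ++ dn) + 2 <= M - 3)
        by (rewrite EE, !length_app in *; simpl in Hlen; lia).
      assert (Huv : u < M /\ v < M).
      { apply HR. rewrite EE, app_assoc. apply in_or_app. right. now left. }
      destruct (nth_flat_edges (E1 ++ dn) u v td) as [Nu Nv].
      assert (EE' : (E1 ++ dn) ++ (u, v) :: td = E1 ++ E2)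
        by (rewrite EE, <- app_assoc; reflexivity).
      rewrite EE', <- Hed in Nu, Nv by lia.
      assert (Nv' : h (M + 2 * length (E1 ++ dn) + 1) = v)
        by (rewrite <- Nv; f_equal; lia).
      run_block; try (rewrite ?Nu, ?Nv'; lia). split; [|simpl; lia].
      rewrite Nu, Nv'.
      exists (dn ++ [(u, v)]), td. do 3 eexists.
      split; [now rewrite <- app_assoc|].
      split; [|split; [|split; [|split; [|split; [|split]]]]].
      * rewrite app_assoc, (length_app (E1 ++ dn)). simpl length. regs_eq.
      * intros k Hk. rewrite !upd_other by lia. auto.
      * repeat (apply tab_upd_other; [lia|]). exact H2.
      * apply tab_upd_other; [lia|]. rewrite rev_app_distr. simpl rev.
        eapply tab_ext; [|apply tab_upd, tab_upd, H3]. intros x _. simpl. reflexivity.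
      * repeat (apply tab_upd_other; [lia|]). exact H4.
      * rewrite rev_app_distr. simpl rev.
        eapply tab_ext; [|apply tab_upd, tab_upd_other, tab_upd_other, H5; lia].
        intros x _. simpl. now destruct (x =? v).
      * intros c Hc. rewrite !upd_other by lia. auto.
    + exists [], E2. do 3 eexists. split; [reflexivity|].
      split; [|split; [|split; [|split; [|split; [|split]]]]].
      * unfold regs. rewrite app_nil_r. reflexivity.
      * exact Hed.
      * exact H2.
      * exact H3.
      * exact H4.
      * intros x Hx. apply Hz. lia.
      * intros c Hc. apply Hz. lia.
  - intros t rs h' ((dn & td & s11 & s12 & s13 & EE & -> & Hed' & H2' & H3' & H4' & H5' & Hz') & H0 & Ht).
    cbn [nth regs] in H0, Ht. destruct td; [|discriminate]. rewrite app_nil_r in EE.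
    subst dn. simpl length in Ht. rewrite length_app in Hlen.
    split; [lia|]. split; [do 8 eexists; reflexivity|]. auto.
Qed.

(** * Walking along the orbits *)

Record tables (M : nat) (m1 : nat -> nat) (o1 : nat -> bool) (m2 : nat -> nat)
    (o2 : nat -> bool) (h : memory) : Prop := {
  tb_m1 : tab h M 2 m1;
  tb_m2 : tab h M 3 m2;
  tb_o1 : tab h M 4 (fun v => turn_bit (o1 v));
  tb_o2 : tab h M 5 (fun v => turn_bit (negb (o2 v))) }.

Lemma tables_upd M m1 o1 m2 o2 h a x : 6 * M <= a ->
  tables M m1 o1 m2 o2 h -> tables M m1 o1 m2 o2 (upd h a x).
Proof. intros Ha []. split; apply tab_upd_other; trivial; lia. Qed.

Definition visited (M : nat) (h : memory) (x : nat) : Prop := h (6 * M + x) <> 0.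

Definition unvisited_count (M : nat) (h : memory) : nat :=
  length (filter (fun x => h (6 * M + x) =? 0) (seq 0 M)).

Lemma unvisited_count_mark M h x : x < M -> ~ visited M h x ->
  unvisited_count M (upd h (6 * M + x) 1) < unvisited_count M h.
Proof.
  intros Hx Hv. unfold visited in Hv. apply (filter_length_lt _ _ _ x).
  - intros y Hy. destruct (Nat.eq_dec y x) as [->|N].
    + apply Nat.eqb_eq. lia.
    + now rewrite upd_other in Hy by lia.
  - apply in_seq. lia.
  - now rewrite upd_same.
  - apply Nat.eqb_eq. lia.
Qed.

Lemma visited_mark M h x y :
  visited M (upd h (6 * M + x) 1) y <-> visited M h y \/ y = x.
Proof.
  unfold visited. destruct (Nat.eq_dec y x) as [->|N].
  - rewrite upd_same. split; [now right|lia].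
  - rewrite upd_other by lia. tauto.
Qed.

Lemma unmatched_free_S m1 m2 x j (y := Nat.iter j (nxt m1 m2) x) :
  unmatched_free m1 m2 x (S j) <->
  unmatched_free m1 m2 x j /\ m1 y <> y /\ m2 (m1 y) <> m1 y.
Proof.
  split.
  - intros H. split; [intros i Hi; apply H; lia|apply (H j); lia].
  - intros [H Hj] i Hi. destruct (Nat.eq_dec i j) as [->|]; [exact Hj|apply H; lia].
Qed.

Lemma wp_walk M m1 o1 m2 o2 res b v k h0 : 64 <= M ->
  (forall x, x < M -> m1 x < M) -> (forall x, x < M -> m2 x < M) ->
  involutive m1 -> involutive m2 -> v < M -> period m1 m2 v k ->
  tables M m1 o1 m2 o2 h0 -> ~ visited M h0 v ->
  (forall x, x < M -> visited M h0 x -> visited M h0 (nxt m1 m2 x)) ->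
  forall r15, wp walk (regs M res b 1 v v 0 0 0 r15) h0 (fun t rs h =>
    t + 40 * unvisited_count M h <= S (40 * unvisited_count M h0) /\
    tables M m1 o1 m2 o2 h /\
    (forall x, visited M h x <->
       visited M h0 x \/ exists i, i < k /\ x = Nat.iter i (nxt m1 m2) v) /\
    exists b r11 A F r15, rs = regs M res b 0 v r11 A (2 * k) F r15 /\
      (2 * Z.of_nat A - Z.of_nat (2 * k) =
       zsum (fun i => weight m1 o1 o2 (Nat.iter i (nxt m1 m2) v)) k)%Z /\
      (F = 0 <-> unmatched_free m1 m2 v k)).
Proof.
  intros HM B1 B2 I1 I2 Hv HP HT0 Hv0 Hcl r15.
  set (f := nxt m1 m2) in *.
  assert (HO : forall i, Nat.iter i f v < M).
  { induction i as [|i IH]; [exact Hv|]. apply B2, B1, IH. }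
  assert (Hk : 0 < k) by apply HP.
  (* The visited set is closed under [nxt], so a visited vertex on this orbit would, going on around
     it, make [v] visited. Hence every round marks a new vertex. *)
  assert (fresh : forall i, i < k -> ~ visited M h0 (Nat.iter i f v)).
  { intros i Hi H. apply Hv0.
    assert (E : Nat.iter k f v = v) by apply HP.
    rewrite <- E. replace k with ((k - i) + i) by lia.
    generalize (k - i). intros d. induction d as [|d IH]; [exact H|].
    apply Hcl; [apply (HO (d + i))|exact IH]. }
  unfold walk. eapply wp_mono.
  - apply (wp_while _ _
      (fun rs h => exists j r2 r9 A F r15,
         rs = regs M res r2 r9 v (Nat.iter j f v) A (2 * j) F r15 /\ j <= k /\
         (j = 0 /\ r9 = 1 \/
          0 < j /\ r9 = (Nat.iter j f v - v) + (v - Nat.iter j f v)) /\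
         (2 * Z.of_nat A - Z.of_nat (2 * j) =
          zsum (fun i => weight m1 o1 o2 (Nat.iter i f v)) j)%Z /\
         (F = 0 <-> unmatched_free m1 m2 v j) /\
         tables M m1 o1 m2 o2 h /\
         (forall x, visited M h x <->
            visited M h0 x \/ exists i, i < j /\ x = Nat.iter i f v))
      (* A round has 29 instructions and costs 31 steps with test and jump; the vertex it marks pays
         40. *)
      (fun _ h => 40 * unvisited_count M h)); [lia| |].
    + clear r15. intros rs h (j & r2 & r9 & A & F & r15 & -> & Hj & H9 & HA & HF & HT & Hvis) Hne.
      cbn [nth regs] in Hne.
      assert (Hjk : j < k).
      { destruct (Nat.eq_dec j k) as [->|]; [|lia].
        assert (E : Nat.iter k f v = v) by apply HP. rewrite E in H9. lia. }
      set (x := Nat.iter j f v) in *.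
      assert (Hx : x < M) by apply HO.
      assert (Hx0 : ~ visited M h x).
      { rewrite Hvis. intros [H|(i & Hi & E)]; [now apply (fresh j)|].
        apply (iter_nxt_distinct m1 m2 v k I1 I2 HP i j); [lia|]. now symmetry. }
      set (h' := upd h (6 * M + x) 1).
      assert (HT' : tables M m1 o1 m2 o2 h') by (apply tables_upd; [lia|trivial]).
      assert (R1 : h' (2 * M + x) = m1 x) by now apply HT'.
      assert (R2 : h' (4 * M + x) = turn_bit (o1 x)) by now apply HT'.
      assert (Hy : m1 x < M) by auto.
      assert (R3 : h' (3 * M + m1 x) = m2 (m1 x)) by now apply HT'.
      assert (R4 : h' (5 * M + m1 x) = turn_bit (negb (o2 (m1 x)))) by now apply HT'.
      run_block; do 2 fold h'.
      rewrite R2, R1, R3, R4.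
      change (m2 (m1 x)) with (Nat.iter (S j) f v) in R3 |- *.
      split.
      * exists (S j). do 5 eexists. split; [|split; [lia|split; [|split; [|split; [|split]]]]].
        -- regs_eq.
        -- right. split; [lia|reflexivity].
        -- cbn [zsum]. rewrite <- HA. unfold weight. fold x.
           destruct (o1 x), (o2 (m1 x)); simpl turn_bit; simpl dir; lia.
        -- rewrite unmatched_free_S, <- HF. fold f. fold x.
           change (Nat.iter (S j) f v) with (m2 (m1 x)). lia.
        -- exact HT'.
        -- intros y. unfold h'. rewrite visited_mark, Hvis. split.
           ++ intros [[H|(i & Hi & E)]| ->]; [auto| |].
              ** right. exists i. split; [lia|trivial].
              ** right. exists j. split; [lia|reflexivity].
           ++ intros [H|(i & Hi & E)]; [auto|].
              destruct (Nat.eq_dec i j) as [->|]; [auto|].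
              left. right. exists i. split; [lia|trivial].
      * assert (L := unvisited_count_mark M h x Hx Hx0). fold h' in L. lia.
    + exists 0. do 5 eexists. split; [reflexivity|]. split; [lia|].
      split; [auto|]. split; [reflexivity|]. split; [split; [intros _ i Hi; lia|trivial]|].
      split; [trivial|]. intros x. split; [auto|]. intros [H|(i & Hi & _)]; [trivial|lia].
  - intros t rs h ((j & r2 & r9 & A & F & s15 & -> & Hj & H9 & HA & HF & HT & Hvis) & Hz & Ht).
    cbn [nth regs] in Hz. subst r9.
    assert (E : Nat.iter j f v = v) by lia.
    assert (j = k).
    { destruct (Nat.eq_dec j k) as [|N]; [trivial|].
      destruct HP as (_ & _ & Hmin). destruct (Hmin j); [lia|exact E]. }
    subst j. split; [exact Ht|]. split; [trivial|]. split; [trivial|].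
    exists r2. do 4 eexists. split; [reflexivity|]. auto.
Qed.

Lemma wp_verdict M m1 o1 m2 o2 v k res b r11 A F r15 h : res <= 1 ->
  period m1 m2 v k ->
  (2 * Z.of_nat A - Z.of_nat (2 * k) =
   zsum (fun i => weight m1 o1 o2 (Nat.iter i (nxt m1 m2) v)) k)%Z ->
  (F = 0 <-> unmatched_free m1 m2 v k) ->
  wp verdict (regs M res b 0 v r11 A (2 * k) F r15) h (fun t rs h' =>
    t <= 10 /\ h' = h /\ exists res' b r9 r11 r12 r13 r14 r15,
      rs = regs M res' b r9 v r11 r12 r13 r14 r15 /\ res' <= 1 /\
      (res' = 1 <-> res = 1 /\ good m1 o1 m2 o2 v)).
Proof.
  intros Hres HP HA HF.
  assert (uniq : forall k', period m1 m2 v k' -> k' = k).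
  { intros k' HP'. destruct HP as (H1 & E & Hmin), HP' as (H1' & E' & Hmin').
    destruct (Nat.lt_total k' k) as [L|[L|L]]; [|trivial|].
    - destruct (Hmin k'); [lia|trivial].
    - destruct (Hmin' k); [lia|trivial]. }
  unfold verdict. apply wp_ifz; [lia| |]; cbn [nth regs]; intros Hz.
  - run_block. split; [lia|]. split; [reflexivity|]. do 8 eexists.
    split; [regs_eq|].
    assert (G : good m1 o1 m2 o2 v <-> Z.abs (2 * Z.of_nat A - Z.of_nat (2 * k)) = 2%Z).
    { rewrite HA. split.
      - intros H. apply H; [trivial|now apply HF].
      - intros H k' HP' _. now rewrite (uniq k' HP'). }
    rewrite G. clear G HA. lia.
  - run_block. split; [lia|]. split; [reflexivity|]. do 8 eexists.
    split; [regs_eq|]. split; [trivial|]. split; [|tauto]. intros ->.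
    split; [trivial|]. intros k' HP' HF'. rewrite (uniq k' HP') in HF'.
    apply HF in HF'. contradiction.
Qed.

Lemma wp_search M m1 o1 m2 o2 a b r9 r10 r11 r12 r13 r14 r15 h : 64 <= M ->
  (forall x, x < M -> m1 x < M) -> (forall x, x < M -> m2 x < M) ->
  involutive m1 -> involutive m2 ->
  tables M m1 o1 m2 o2 h -> (forall x, x < M -> ~ visited M h x) ->
  wp search (regs M a b r9 r10 r11 r12 r13 r14 r15) h (fun t rs h' =>
    t <= 100 * M /\ exists res b r9 r10 r11 r12 r13 r14 r15,
      rs = regs M res b r9 r10 r11 r12 r13 r14 r15 /\
      (res = 1 <-> forall x, x < M -> good m1 o1 m2 o2 x)).
Proof.
  intros HM B1 B2 I1 I2 HT Hno. unfold search. apply wp_seq. run_block.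
  assert (Hcount : unvisited_count M h <= M).
  { unfold unvisited_count. rewrite <- (length_seq M 0) at 2. apply filter_length_le. }
  assert (Hperiod : forall v, v < M -> exists k, period m1 m2 v k).
  { intros v Hv. apply (period_exists m1 m2 (seq 0 M)); trivial.
    - intros y Hy. apply in_seq in Hy. apply in_seq. unfold nxt.
      specialize (B2 (m1 y)). specialize (B1 y). lia.
    - apply in_seq. lia. }
  eapply wp_mono.
  - apply (wp_while _ _
      (fun rs h => exists res b r9 v r11 r12 r13 r14 r15,
         rs = regs M res b r9 v r11 r12 r13 r14 r15 /\ v <= M /\ res <= 1 /\
         tables M m1 o1 m2 o2 h /\
         (forall x, x < M -> visited M h x -> visited M h (nxt m1 m2 x)) /\
         (forall x, v <= x < M -> visited M h x) /\
         (res = 1 <-> forall x, x < M -> visited M h x -> good m1 o1 m2 o2 x))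
      (* Each scanned index pays 30 for the overhead of its own round, including the verdict; the
         rounds of [walk] are paid for by the vertices they mark. *)
      (fun rs h => 30 * nth 10 rs 0 + 40 * unvisited_count M h)); [lia| |].
    + clear dependent h. clear b r9 r11 r12 r13 r14 r15.
      intros rs h (res & b & r9 & v & r11 & r12 & r13 & r14 & r15 & -> & Hv & Hres
                   & HT & Hcl & Hdone & Hgood) Hne.
      cbn [nth regs] in Hne. apply wp_seq. run_block.
      assert (Hv' : v - 1 < M) by lia.
      apply wp_ifz; [lia| |]; cbn [nth]; intros Hz.
      * apply wp_seq. run_block. apply wp_seq.
        destruct (Hperiod (v - 1) Hv') as [k HP].
        assert (Hk : 0 < k) by apply HP.
        assert (Hnv : ~ visited M h (v - 1)) by (unfold visited; lia).
        replace (v - 1 + 0) with (v - 1) by lia.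
        eapply wp_mono;
          [apply (wp_walk M m1 o1 m2 o2 res b (v - 1) k h HM B1 B2 I1 I2 Hv' HP HT Hnv Hcl)|].
        intros t rs h' (Ht & HT' & Hvis & b' & r11' & A & F & r15' & -> & HA & HF).
        eapply wp_mono;
          [apply (wp_verdict M m1 o1 m2 o2 (v - 1) k res b' r11' A F r15' h' Hres HP HA HF)|].
        intros t2 rs h2 (Ht2 & -> & res' & b2 & s9 & s11 & s12 & s13 & s14 & s15 & -> & Hres' & Hr).
        split; [|cbn [nth regs]; lia].
        exists res', b2, s9, (v - 1), s11, s12, s13, s14, s15.
        split; [reflexivity|]. split; [lia|]. split; [trivial|]. split; [trivial|].
        split; [|split].
        -- intros x Hx Hvx. rewrite Hvis in Hvx |- *.
           destruct Hvx as [Hvx|(i & Hi & ->)]; [auto|]. right.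
           destruct (Nat.eq_dec (S i) k) as [E|N].
           ++ exists 0. split; [trivial|].
              change (Nat.iter (S i) (nxt m1 m2) (v - 1) = v - 1).
              rewrite E. apply HP.
           ++ exists (S i). split; [lia|reflexivity].
        -- intros x Hx. apply Hvis. destruct (Nat.eq_dec x (v - 1)) as [->|].
           ++ right. exists 0. auto.
           ++ left. apply Hdone. lia.
        -- rewrite Hr, Hgood. split.
           ++ intros [H Hg] x Hx Hvx. apply Hvis in Hvx as [Hvx|(i & _ & ->)]; [auto|].
              clear Hx. induction i as [|i IH]; [exact Hg|]. now apply good_nxt.
           ++ intros H. split.
              ** intros x Hx Hvx. apply H; [trivial|]. apply Hvis. auto.
              ** apply H; [trivial|]. apply Hvis. right. exists 0. auto.
      * run_block. split; [|lia].
        exists res, b, r9, (v - 1). do 5 eexists. split; [regs_eq|].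
        split; [lia|]. split; [trivial|]. split; [trivial|]. split; [trivial|].
        split; [|trivial]. intros x Hx.
        destruct (Nat.eq_dec x (v - 1)) as [->|]; [exact Hz|apply Hdone; lia].
    + exists 1, b, 0, M, r11, r12, r13, r14, r15.
      split; [regs_eq|]. split; [lia|]. split; [lia|]. split; [trivial|].
      split; [|split; [lia|]].
      * intros x Hx H. now destruct (Hno x Hx).
      * split; [|trivial]. intros _ x Hx H. now destruct (Hno x Hx).
  - intros t rs h' ((res & b' & s9 & v & s11 & s12 & s13 & s14 & s15 & -> & Hv & Hres
                   & HT' & Hcl & Hdone & Hgood) & Hz & Ht).
    cbn [nth regs] in Hz, Ht. subst v. split; [lia|].
    exists res, b'. do 7 eexists. split; [reflexivity|]. rewrite Hgood.
    split; intros H x Hx; [apply H; [trivial|apply Hdone; lia]|auto].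
Qed.

(** * Size bounds and the decision procedure *)

Lemma NoDup_flat_edges E : is_matching E -> NoDup (flat_edges E).
Proof.
  assert (In_flat : forall E x, In x (flat_edges E) ->
            exists u v, In (u, v) E /\ (x = u \/ x = v)).
  { clear E. induction E as [|[u v] E IH]; simpl; [easy|]. intros x [->|[->|H]].
    - exists x, v. auto.
    - exists u, x. auto.
    - destruct (IH x H) as (u' & v' & H' & Hx). exists u', v'. auto. }
  induction E as [|[u v] E IH]; intros (ND & L & D); [constructor|].
  inversion ND as [|? ? Hn ND']; subst. simpl.
  assert (far : forall x, x = u \/ x = v -> ~ In x (flat_edges E)).
  { intros x Hx H. destruct (In_flat E x H) as (u' & v' & H' & Hx').
    assert (N : (u, v) <> (u', v')) by (intros E'; injection E' as -> ->; contradiction).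
    specialize (D u v u' v' (or_introl eq_refl) (or_intror H') N). lia. }
  assert (Huv : u <> v) by (apply L; now left).
  constructor; [|constructor].
  - intros [E'|H]; [auto|]. now apply (far u); auto.
  - apply far. auto.
  - apply IH. split; [trivial|]. split.
    + intros u' v' H. apply L. now right.
    + intros u1 v1 u2 v2 H1 H2. apply D; now right.
Qed.

(** The endpoints of a matching are distinct vertices. The bound makes both edge lists fit into
    [M - 3] cells and keeps the loading time linear in [n]. *)
Lemma matching_size n E : edges_in_range n E -> is_matching E -> 2 * length E <= n.
Proof.
  intros HR HE. rewrite <- length_flat_edges, <- (length_seq n 0).
  apply NoDup_incl_length; [now apply NoDup_flat_edges|].
  clear HE. induction E as [|[u v] E IH]; simpl; [easy|].
  assert (R := HR u v (or_introl eq_refl)).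
  intros x [->|[->|Hx]]; try (apply in_seq; lia).
  apply IH; trivial. intros u' v' H. apply HR. now right.
Qed.

Lemma mate_range n E x : edges_in_range n E ->
  mate E x = x \/ (x < n /\ mate E x < n).
Proof.
  intros HR. destruct (mate_cases E x) as [H|[H|[H _]]]; [| |auto];
    right; apply HR in H; tauto.
Qed.

Lemma edges_in_range_rev n E : edges_in_range n E -> edges_in_range n (rev E).
Proof. intros H u v Huv. apply H. now apply in_rev. Qed.

Lemma embeddable_iff_good n M E1 E2 : valid_instance n E1 E2 -> n <= M ->
  (upward_mp2_book_embeddable n E1 E2 <->
   forall x, x < M -> good (mate (rev E1)) (is_tail (rev E1))
     (mate (rev E2)) (fun v => negb (is_head (rev E2) v)) x).
Proof.
  intros (HR & _ & HM1 & HM2 & _) HnM.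
  set (m1 := mate (rev E1)). set (o1 := is_tail (rev E1)).
  set (m2 := mate (rev E2)). set (o2 := fun v => negb (is_head (rev E2) v)).
  assert (R1 : represents E1 m1 o1)
    by (apply represents_rev, represents_tail, is_matching_rev, HM1).
  assert (R2 : represents E2 m2 o2)
    by (apply represents_rev, represents_head, is_matching_rev, HM2).
  assert (HR1 : edges_in_range n (rev E1)).
  { apply edges_in_range_rev. intros u v H. apply HR, in_or_app. auto. }
  assert (HR2 : edges_in_range n (rev E2)).
  { apply edges_in_range_rev. intros u v H. apply HR, in_or_app. auto. }
  destruct (embeddable_iff n E1 E2 m1 o1 m2 o2 HR R1 R2) as [F G].
  destruct R1 as [I1 O1 _], R2 as [I2 O2 _].
  (* Indices from [n] on are fixed by [mate], so they violate [unmatched_free] at once; testing all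
     indices below [M] gives the same result as testing the vertices. *)
  assert (outside : forall x, n <= x -> good m1 o1 m2 o2 x).
  { intros x Hx k (Hk & _) HF. destruct (HF 0 Hk) as [N _]. destruct N.
    destruct (mate_range n (rev E1) x HR1) as [E|E]; [exact E|lia]. }
  assert (all : (forall x, x < M -> good m1 o1 m2 o2 x) ->
                forall x, good m1 o1 m2 o2 x).
  { intros H x. destruct (Nat.lt_ge_cases x n); [apply H; lia|auto]. }
  split.
  - intros H x _. destruct (F H) as [p Hp].
    destruct (Nat.lt_ge_cases x n) as [L|L]; [|auto].
    apply (good_of_embeds (fun x => x < n) m1 o1 m2 o2 p); trivial.
    + intros y Hy. destruct (mate_range n (rev E1) y HR1); unfold m1; lia.
    + intros y Hy. destruct (mate_range n (rev E2) y HR2); unfold m2; lia.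
  - intros H. apply G.
    destruct (embeds_of_good m1 o1 m2 o2 I1 I2 O1 O2 (all H) (seq 0 n)) as [p Hp].
    exists p. revert Hp. apply embeds_weaken. intros x Hx. apply in_seq. lia.
Qed.

(** The factor 142 is 8 + 8 + 13 + 13 + 100, the bounds for copying, initializing, loading the two
    matchings and searching, in units of [64 * n]. The remaining blocks and the outer test take a
    constant number of steps, covered by 60. *)
Lemma wp_decide n E1 E2 : valid_instance n E1 E2 ->
  let enc := encode n E1 E2 in
  wp decide (map enc (seq 0 16)) enc (fun t rs _ =>
    t <= 142 * 64 * n + 60 /\
    (nth 0 rs 0 = 1 <-> upward_mp2_book_embeddable n E1 E2)).
Proof.
  intros HV enc. assert (HV' := HV). destruct HV' as (HR & _ & HM1 & HM2 & _).
  assert (E0 : enc 0 = n) by reflexivity.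
  assert (Ea : enc 1 = length E1) by reflexivity.
  assert (Eb : enc 2 = length E2) by reflexivity.
  assert (Ee : forall k, enc (3 + k) = nth k (flat_edges (E1 ++ E2)) 0) by reflexivity.
  assert (HR1 : edges_in_range n E1) by (intros u v H; apply HR, in_or_app; auto).
  assert (HR2 : edges_in_range n E2) by (intros u v H; apply HR, in_or_app; auto).
  assert (L1 := matching_size n E1 HR1 HM1). assert (L2 := matching_size n E2 HR2 HM2).
  set (M := 64 * n).
  assert (HG := embeddable_iff_good n M E1 E2 HV ltac:(unfold M; lia)).
  unfold decide. apply wp_ifz; [lia| |]; cbn [nth map seq]; rewrite E0; intros Hn.
  { run_block. split; [lia|]. split; [|trivial]. intros _. apply HG. intros x Hx. lia. }
  assert (HM : 64 <= M) by (unfold M; lia).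
  assert (Hlen : 2 * length (E1 ++ E2) <= M - 3) by (rewrite length_app; unfold M; lia).
  assert (HRM : edges_in_range M (E1 ++ E2)).
  { intros u v H. apply HR in H. unfold M. lia. }
  apply wp_seq. rewrite <- E0 at 1.
  eapply wp_mono; [apply (wp_double enc)|]. intros t0 rs0 h0 (-> & -> & ->).
  apply wp_seq. rewrite E0. fold M.
  eapply wp_mono; [apply (wp_relocate M enc HM)|].
  intros t1 rs1 h1 (-> & (r12 & r13 & r14 & r15 & ->) & Hlow & Hrest).
  apply wp_seq. rewrite Ea, Eb.
  eapply wp_mono; [apply (wp_copy M _ _ _ _ _ _ enc h1 HM Hlow Hrest)|].
  { intros c Hc. replace c with (3 + (c - 3)) by lia. rewrite Ee.
    apply nth_overflow. rewrite length_flat_edges. lia. }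
  clear r12 r13 r14 r15 Hlow Hrest.
  intros t2 rs2 h2 (Ht2 & (r9 & r10 & r11 & r12 & r13 & r14 & r15 & ->) & Hed2 & Hz2).
  apply wp_seq.
  eapply wp_mono; [apply (wp_init M _ _ _ _ _ _ _ _ _ enc h2 HM Hed2 Hz2)|].
  clear r9 r10 r11 r12 r13 r14 r15.
  intros t3 rs3 h3 (Ht3 & (r9 & r10 & r11 & r12 & r13 & r14 & r15 & ->) & Hed3 & Ta & Tb & Hz3).
  apply wp_seq.
  eapply wp_mono;
    [apply (wp_load_E1 M _ _ _ _ _ _ _ _ E1 E2 h3 HM Hlen HRM Hed3 Ta Tb Hz3)|].
  clear r9 r10 r11 r12 r13 r14 r15 Ta Tb.
  intros t4 rs4 h4 (Ht4 & (r10 & r11 & r12 & r13 & r14 & r15 & ->) & Hed4 & Ta & Tb & Tc & Hz4).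
  apply wp_seq.
  eapply wp_mono;
    [apply (wp_load_E2 M _ _ _ _ _ _ E1 E2 h4 _ _ HM Hlen HRM Hed4 Ta Tb Tc Hz4)|].
  clear r10 r11 r12 r13 r14 r15 Ta Tb Tc.
  intros t5 rs5 h5 (Ht5 & (b & r9 & r10 & r11 & r12 & r13 & r14 & r15 & ->) & Ta & Tb & Tc & Td & Hz5).
  apply wp_seq.
  assert (HT : tables M (mate (rev E1)) (is_tail (rev E1)) (mate (rev E2))
                 (fun v => negb (is_head (rev E2) v)) h5).
  { split; trivial. eapply tab_ext; [|exact Td]. intros v _. simpl.
    now rewrite negb_involutive. }
  eapply wp_mono; [apply (wp_search M _ _ _ _ _ _ _ _ _ _ _ _ _ h5 HM) with (5 := HT)|].
  - intros x Hx. destruct (mate_range n (rev E1) x) as [E|E];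
      [now apply edges_in_range_rev|lia|unfold M; lia].
  - intros x Hx. destruct (mate_range n (rev E2) x) as [E|E];
      [now apply edges_in_range_rev|lia|unfold M; lia].
  - intros x. apply (represents_tail (rev E1)), is_matching_rev, HM1.
  - intros x. apply (represents_tail (rev E2)), is_matching_rev, HM2.
  - intros x Hx H. apply H, Hz5. lia.
  - clear r9 r10 r11 r12 r13 r14 r15.
    intros t6 rs6 h6 (Ht6 & res & b' & r9 & r10 & r11 & r12 & r13 & r14 & r15 & -> & Hres).
    run_block. split; [unfold M in *; lia|]. rewrite Nat.add_0_r, HG. exact Hres.
Qed.

(* There is a fixed RAM program P and a constant c such that on every valid
   instance with n vertices, P halts within c*n + c steps and outputs
   (in cell 0) 1 iff the instance is a positive instance. *)
Theorem theorem3 :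
  exists (P : program) (c : nat),
    forall (n : nat) (E1 E2 : list edge),
      valid_instance n E1 E2 ->
      let cfg := run P (encode n E1 E2) (c * n + c) in
      halted P cfg /\
      (snd cfg 0 = 1 <-> upward_mp2_book_embeddable n E1 E2).
Proof.
  exists (compile 0 decide), (142 * 64). intros n E1 E2 HV cfg.
  destruct (wp_decide n E1 E2 HV (encode n E1 E2)) as (t & m' & rs & h & He & Hm & Ht & HQ).
  - split; [reflexivity|]. split; [|trivial].
    intros i Hi. do 16 (destruct i as [|i]; [reflexivity|]). lia.
  - destruct (run_compiled decide _ t m' (142 * 64 * n + 142 * 64) He) as [Hrun Hh]; [lia|].
    unfold cfg. rewrite Hrun. split; [exact Hh|]. cbn [snd].
    rewrite <- HQ. destruct Hm as (_ & Hm & _). rewrite Hm by lia. reflexivity.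
Qed.
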